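(* Let $M$ be a non-deterministic $\lambda$-term. (1) If $M$ is strongly normalizable, then $\mathcal T(M)\in(\uparrow\mathfrak T)^\perp$ for every structure $\mathfrak T\subseteq\mathfrak B$. (2) If $\mathfrak T$ is a structure with $\mathfrak L\subseteq\mathfrak T$ and $\mathcal T(M)\in(\uparrow\mathfrak T)^\perp$, then $M$ is strongly normalizable.
   Context: Non-deterministic $\lambda$-terms are given by $M::=x\mid\lambda x.M\mid (M)N\mid M+N$, taken up to $\alpha$-equivalence and the identities $M+N=N+M$, $(M+N)+P=M+(N+P)$, $\lambda x.(M+N)=\lambda x.M+\lambda x.N$, $(M+N)P=(M)P+(N)P$. Application is not linear in its argument, and $+$ is not idempotent. $\beta$-reduction $\to_\beta$ is the contextual closure of $(\lambda x.M)N\to_\beta M[N/x]$. The term $M$ is strongly normalizable if there is no infinite $\beta$-reduction sequence starting from $M$. Resource terms are given by $s::=x\mid\lambda x.s\mid\langle s\rangle\bar t$, where a bag $\bar t=[t_1,\dots,t_n]$ ($n\ge0$) is a finite multiset of resource terms; they are taken up to $\alpha$-equivalence. $\Delta$ denotes the set of resource terms. For $a\subseteq\Delta$, $a^!$ is the set of all bags all of whose elements lie in $a$. The support of the Taylor expansion $\mathcal T(M)\subseteq\Delta$ is defined by: - $\mathcal T(x)=\{x\}$; - $\mathcal T(\lambda x.M)=\{\lambda x.s: s\in\mathcal T(M)\}$; - $\mathcal T((M)N)=\{\langle s\rangle\bar t: s\in\mathcal T(M),\ \bar t\in\mathcal T(N)^!\}$; - $\mathcal T(M+N)=\mathcal T(M)\cup\mathcal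 T(N)$. Resource reduction. For $t\in\Delta$ and a bag $[s_1,\dots,s_n]$, the differential substitution $t\langle[s_1,\dots,s_n]/x\rangle$ is a finite formal sum with natural number coefficients. If $x$ has exactly $n$ free occurrences $x_1,\dots,x_n$ in $t$, it is $\sum_{f\in S_n} t[s_{f(1)}/x_1,\dots,s_{f(n)}/x_n]$, where occurrence $x_i$ is replaced by $s_{f(i)}$; otherwise it is $0$. Resource reduction $\to_r$ acts on finite formal sums of resource terms (constructors extended linearly). It is the smallest relation containing $\langle\lambda x.t\rangle[s_1,\dots,s_n]\to_r t\langle[s_1,\dots,s_n]/x\rangle$ and such that whenever $t\to_r a$ we have: - $\lambda x.t\to_r\lambda x.a$; - $\langle t\rangle\bar s\to_r\langle a\rangle\bar s$; - $\langle u\rangle([t]+\bar s)\to_r\langle u\rangle([a]+\bar s)$; - $\alpha t+b\to_r\alpha a+b$ for nonzero scalars $\alpha$. For $s,t\in\Delta$ write $t\ge s$ if $t\to_r^* a$ for some sum $a$ whose support contains $s$. For $a\subseteq\Delta$, the cone is $\uparrow a=\{t\in\Delta:\exists s\in a,\ t\ge s\}$. A structure is any $\mathfrak T\subseteq\mathcal P(\Delta)$. Set $\uparrow\mathfrak T=\{\uparrow a: a\in\mathfrak T\}$. For a structure $\mathfrak S$, $\mathfrak S^\perp=\{a\subseteq\Delta:\forall a'\in\mathfrak S,\ a\cap a'\text{ is finite}\}$. A resource term is linear if every bag occurring in it has cardinality exactly $1$. $\mathfrak L$ is the set of all sets of linear resource terms. $\mathfrak B$ is the set of all $a\subseteq\Delta$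 for which some $n\in\mathbb N$ bounds the cardinality of every bag occurring in every term of $a$. *)

(* Defs.v *)
From HB Require Import structures.
From Stdlib Require Relation_Operators.
From mathcomp Require Import all_boot perm.
From mathcomp Require Import finmap multiset.
From mathcomp Require Import boolp classical_sets functions cardinality.

Set Implicit Arguments.
Unset Strict Implicit.
Unset Printing Implicit Defensive.

Local Open Scope mset_scope.
Local Open Scope classical_set_scope.
Local Open Scope nat_scope.

(** Terms are in de Bruijn notation, so that alpha-equivalence is syntactic
    equality; the algebraic identities are the congruence [nd_eq] below. *)
Inductive ndterm : Type :=
| NVar of nat
| NLam of ndterm
| NApp of ndterm & ndterm
| NAdd of ndterm & ndterm.

Inductive nd_eq : ndterm -> ndterm -> Prop :=
| nd_refl M : nd_eq M M
| nd_sym M N : nd_eq M N -> nd_eq N M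
| nd_trans M N P : nd_eq M N -> nd_eq N P -> nd_eq M P
| nd_lam M M' : nd_eq M M' -> nd_eq (NLam M) (NLam M')
| nd_app M M' N N' :
    nd_eq M M' -> nd_eq N N' -> nd_eq (NApp M N) (NApp M' N')
| nd_add M M' N N' :
    nd_eq M M' -> nd_eq N N' -> nd_eq (NAdd M N) (NAdd M' N')
| nd_addC M N : nd_eq (NAdd M N) (NAdd N M)
| nd_addA M N P : nd_eq (NAdd (NAdd M N) P) (NAdd M (NAdd N P))
| nd_lamD M N : nd_eq (NLam (NAdd M N)) (NAdd (NLam M) (NLam N))
| nd_appD M N P : nd_eq (NApp (NAdd M N) P) (NAdd (NApp M P) (NApp N P)).

Fixpoint nlift (k : nat) (M : ndterm) : ndterm :=
  match M with
  | NVar i => NVar (if i < k then i else i.+1)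
  | NLam M => NLam (nlift k.+1 M)
  | NApp M N => NApp (nlift k M) (nlift k N)
  | NAdd M N => NAdd (nlift k M) (nlift k N)
  end.

(** [nsubst k N M] replaces the index [k] by [N] in [M] and lowers the indices
    above [k], the binder of [k] being removed. *)
Fixpoint nsubst (k : nat) (N M : ndterm) : ndterm :=
  match M with
  | NVar i => if i == k then N else NVar (if k < i then i.-1 else i)
  | NLam M => NLam (nsubst k.+1 (nlift 0 N) M)
  | NApp M P => NApp (nsubst k N M) (nsubst k N P)
  | NAdd M P => NAdd (nsubst k N M) (nsubst k N P)
  end.

Inductive nd_beta : ndterm -> ndterm -> Prop :=
| nb_beta M N : nd_beta (NApp (NLam M) N) (nsubst 0 N M)
| nb_lam M M' : nd_beta M M' -> nd_beta (NLam M) (NLam M')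
| nb_appl M M' N : nd_beta M M' -> nd_beta (NApp M N) (NApp M' N)
| nb_appr M N N' : nd_beta N N' -> nd_beta (NApp M N) (NApp M N')
| nb_addl M M' N : nd_beta M M' -> nd_beta (NAdd M N) (NAdd M' N)
| nb_addr M N N' : nd_beta N N' -> nd_beta (NAdd M N) (NAdd M N').

(** Beta-reduction between classes modulo [nd_eq]. *)
Definition nd_step (M N : ndterm) : Prop :=
  exists M' N', [/\ nd_eq M M', nd_beta M' N' & nd_eq N' N].

Definition strongly_normalizable (M : ndterm) : Prop :=
  ~ exists f : nat -> ndterm, f 0 = M /\ forall n, nd_step (f n) (f n.+1).

(** Raw resource terms, with lists instead of multisets as bags. *)
Inductive rtree : Type :=
| RVar of nat
| RLam of rtree
| RApp of rtree & seq rtree.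

Fixpoint rtree_enc (t : rtree) : GenTree.tree nat :=
  match t with
  | RVar i => GenTree.Leaf i
  | RLam t => GenTree.Node 0 [:: rtree_enc t]
  | RApp s ts => GenTree.Node 1 (rtree_enc s :: map rtree_enc ts)
  end.

Fixpoint rtree_dec (u : GenTree.tree nat) : option rtree :=
  match u with
  | GenTree.Leaf i => Some (RVar i)
  | GenTree.Node 0 [:: u] => omap RLam (rtree_dec u)
  | GenTree.Node _ (u :: us) =>
      omap (fun s => RApp s (pmap rtree_dec us)) (rtree_dec u)
  | _ => None
  end.

Lemma rtree_encK : pcancel rtree_enc rtree_dec.
Proof.
rewrite /pcancel; fix IH 1; case=> [i|t|s ts] //=; first by rewrite IH.
rewrite IH /=; congr (Some (RApp _ _)).
by elim: ts => //= t ts ->; rewrite IH.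
Qed.

HB.instance Definition _ := Countable.copy rtree (pcan_type rtree_encK).

Definition rtree_le (s t : rtree) : bool := choice.pickle s <= choice.pickle t.

Lemma rtree_le_total : total rtree_le.
Proof. by move=> s t; apply: leq_total. Qed.

(** A bag is represented by its enumeration sorted along the (arbitrary) total
    order [rtree_le]: hence equality of [rterm]s is equality of resource terms
    whose bags are multisets. *)
Fixpoint canonical (t : rtree) : bool :=
  match t with
  | RVar _ => true
  | RLam t => canonical t
  | RApp s ts => [&& canonical s, all canonical ts & sorted rtree_le ts]
  end.

Record rterm : Type := RTerm { rtval : rtree; rtvalP : canonical rtval }.

HB.instance Definition _ := [isSub for rtval].
HB.instance Definition _ := [Countable of rterm by <:].

Definition rvar (i : nat) : rterm := @RTerm (RVar i) isT.
Definition rlam (t : rterm) : rterm := @RTerm (RLam (rtval t)) (rtvalP t).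

Definition bag_list (b : {mset rterm}) : seq rtree :=
  path.sort rtree_le [seq rtval t | t <- enum_mset b].

Lemma rapp_canonical (s : rterm) (b : {mset rterm}) :
  canonical (RApp (rtval s) (bag_list b)).
Proof.
rewrite /= rtvalP all_sort sort_sorted ?andbT; last exact: rtree_le_total.
by apply/allP=> _ /mapP[t _ ->]; apply: rtvalP.
Qed.

Definition rapp (s : rterm) (b : {mset rterm}) : rterm :=
  RTerm (rapp_canonical s b).

(** The resource term obtained by forgetting the order in all bags. *)
Fixpoint rnorm (t : rtree) : rterm :=
  match t with
  | RVar i => rvar i
  | RLam t => rlam (rnorm t)
  | RApp s ts => rapp (rnorm s) (seq_mset (map rnorm ts))
  end.

Definition bang (a : set rterm) : set {mset rterm} :=
  [set b : {mset rterm} | forall t, t \in b -> a t].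

Fixpoint taylor (M : ndterm) : set rterm :=
  match M with
  | NVar i => [set rvar i]
  | NLam M => [set rlam s | s in taylor M]
  | NApp M N => [set rapp s b | s in taylor M & b in bang (taylor N)]
  | NAdd M N => taylor M `|` taylor N
  end.

Lemma taylor_nd_eq M N : nd_eq M N -> taylor M = taylor N.
Proof.
elim=> //= {M N}.
- by move=> M N P _ -> _ ->.
- by move=> M M' _ ->.
- by move=> M M' N N' _ -> _ ->.
- by move=> M M' N N' _ -> _ ->.
- by move=> M N; rewrite setUC.
- by move=> M N P; rewrite setUA.
- by move=> M N; rewrite image_setU.
- move=> M N P; apply/seteqP; split=> t /=.
  + by case=> s [] Hs [b Hb <-]; [left|right]; exists s => //; exists b.
  + by case=> -[s Hs [b Hb <-]]; exists s; [left| |right|] => //; exists b.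
Qed.

(** Finite formal sums with coefficients in [nat] are finitely supported
    functions [rterm -> nat], that is, multisets of resource terms. *)
Notation rsum := {mset rterm} (only parsing).

Definition lin_ext (f : rterm -> rterm) (a : rsum) : rsum :=
  seq_mset [seq f t | t <- enum_mset a].

Definition sum_scale (n : nat) (a : rsum) : rsum := iter n (msetD a) mset0.

Fixpoint nocc (k : nat) (t : rtree) : nat :=
  match t with
  | RVar i => i == k
  | RLam t => nocc k.+1 t
  | RApp s ts => nocc k s + sumn (map (nocc k) ts)
  end.

Fixpoint rlift (k : nat) (t : rtree) : rtree :=
  match t with
  | RVar i => RVar (if i < k then i else i.+1)
  | RLam t => RLam (rlift k.+1 t)
  | RApp s ts => RApp (rlift k s) (map (rlift k) ts)
  end.

(** If [size l = nocc k t], [occ_subst k l t] replaces the successive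
    occurrences, from left to right, of the index [k] in [t] by the successive
    elements of [l], and lowers the indices above [k]. *)
Fixpoint occ_subst (k : nat) (l : seq rtree) (t : rtree) : rtree :=
  match t with
  | RVar i =>
      if i == k then head (RVar 0) l else RVar (if k < i then i.-1 else i)
  | RLam t => RLam (occ_subst k.+1 (map (rlift 0) l) t)
  | RApp s ts =>
      RApp (occ_subst k (take (nocc k s) l) s)
        ((fix go (l : seq rtree) (ts : seq rtree) : seq rtree :=
            match ts with
            | [::] => [::]
            | t :: ts =>
                occ_subst k (take (nocc k t) l) t :: go (drop (nocc k t) l) ts
            end) (drop (nocc k s) l) ts)
  end.

(** The differential substitution of the bag [b] for the index 0 in [t]. The
    sum over all permutations depends neither on the enumeration of [b] nor on
    the order of the occurrences in [t]. *)
Definition diff_subst (t : rterm) (b : {mset rterm}) : rsum :=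
  let s := in_tuple (enum_mset b) in
  if nocc 0 (rtval t) == size b then
    \big[msetD/mset0]_(f : 'S_(size b))
       [mset rnorm
          (occ_subst 0 [seq rtval (tnth s (f i)) | i : 'I_(size b)] (rtval t))]
  else mset0.

(** Reduction is presented in two layers: [rred1] reduces a single term to a
    sum, and [rred] is its extension to sums. *)
Inductive rred1 : rterm -> rsum -> Prop :=
| rr_beta t b : rred1 (rapp (rlam t) b) (diff_subst t b)
| rr_lam t a : rred1 t a -> rred1 (rlam t) (lin_ext rlam a)
| rr_appl t a b : rred1 t a -> rred1 (rapp t b) (lin_ext (rapp^~ b) a)
| rr_appr u t a b : rred1 t a ->
    rred1 (rapp u (t +` b)%mset) (lin_ext (fun t' => rapp u (t' +` b)%mset) a).

Inductive rred : rsum -> rsum -> Prop :=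
| rr_sum n t a b : n != 0 -> rred1 t a ->
    rred (msetn n t `+` b)%mset (sum_scale n a `+` b)%mset.

Definition rreds : rsum -> rsum -> Prop :=
  Relation_Operators.clos_refl_trans rsum rred.

Definition rge (t s : rterm) : Prop :=
  exists2 a : rsum, rreds [mset t] a & s \in a.

Definition cone (a : set rterm) : set rterm :=
  [set t | exists2 s, a s & rge t s].

Definition structure : Type := set (set rterm).

Definition cones (T : structure) : structure := [set cone a | a in T].

Definition orth (S : structure) : structure :=
  [set a | forall a', S a' -> finite_set (a `&` a')].

Fixpoint all_bag_sizes (p : pred nat) (t : rtree) : bool :=
  match t with
  | RVar _ => true
  | RLam t => all_bag_sizes p t
  | RApp s ts =>
      [&& p (size ts), all_bag_sizes p s & all (all_bag_sizes p) ts]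
  end.

Definition linear_rterm (t : rterm) : bool :=
  all_bag_sizes (pred1 1) (rtval t).

Definition linear_structure : structure :=
  [set a | forall t, a t -> linear_rterm t].

Definition bounded_structure : structure :=
  [set a | exists n, forall t, a t -> all_bag_sizes (leq^~ n) (rtval t)].

(* Main.v *)
(** Everything is reduced to sizes: the elements of [taylor M] of bounded size
    form a finite set, so a subset of [taylor M] is finite iff the sizes of its
    elements are bounded.

    (1) Let [t] in [taylor M] reduce to a term with bags of size at most [n].
    Resource reductions can be rearranged to fire head redexes first, so either
    the outermost application of [t] is never fired, and then its bag has at
    most [n] elements and its components are bounded by induction on subterms of
    [M]; or the head redex is fired first, giving an element of the Taylor
    expansion of a reduct of [M], and a head step at most doubles sizes
    backwards. This is an induction on reducts and subterms of [M].

    (2) If all [t] in [taylor M] that reduce to a linear term have size less than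
    [K], then the same holds with a smaller bound for the arguments of [M], for
    the body of [M] when it is an abstraction, and for its head reduct, because
    each resource reduction step strictly decreases sizes and every term has a
    linear element in its Taylor expansion. By induction on [K] this yields a
    weight of [M], which is invariant under [nd_eq] and decreases at each
    beta-step. *)
From Stdlib Require Relation_Operators.
Require Import Defs.
From mathcomp Require Import all_boot perm finmap multiset zify.
From mathcomp Require Import boolp functions cardinality classical_sets.

Set Implicit Arguments.
Unset Strict Implicit.
Unset Printing Implicit Defensive.

Local Open Scope mset_scope.
Local Open Scope classical_set_scope.
Local Open Scope nat_scope.

(** * Weights of non-deterministic terms *)

Inductive star (T : Type) (R : T -> T -> Prop) : T -> T -> Prop :=
| star_refl x : star R x x
| star_step x y z : R x y -> star R y z -> star R x z.

Lemma star1 T (R : T -> T -> Prop) x y : R x y -> star R x y.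
Proof. by move=> r; apply: star_step r (star_refl _ _). Qed.

Lemma star_trans T (R : T -> T -> Prop) x y z :
  star R x y -> star R y z -> star R x z.
Proof. by elim=> {x y} // x y w r _ IH /IH; apply: star_step. Qed.

Lemma star_map T U (R : T -> T -> Prop) (S : U -> U -> Prop) (f : T -> U) :
  (forall x y, R x y -> S (f x) (f y)) ->
  forall x y, star R x y -> star S (f x) (f y).
Proof.
by move=> fP x y; elim=> {x y} *; [apply: star_refl|apply: star_step; eauto].
Qed.

(** * De Bruijn lifting and substitution, with the congruence and beta-reduction *)

Lemma nlift_nlift i k M :
  i <= k -> nlift k.+1 (nlift i M) = nlift i (nlift k M).
Proof.
elim: M i k => /= [x|M IH|M IHM N IHN|M IHM N IHN] i k le_ik.
- by congr NVar; do ?case: ifP; lia.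
- by rewrite IH.
- by rewrite IHM ?IHN.
- by rewrite IHM ?IHN.
Qed.

Lemma nlift_nsubst_le i k N M :
  i <= k -> nlift i (nsubst k N M) = nsubst k.+1 (nlift i N) (nlift i M).
Proof.
elim: M i k N => /= [x|M IH|M IHM P IHP|M IHM P IHP] i k N le_ik;
  rewrite ?IHM ?IHP // ?IH ?nlift_nlift //.
case: (eqVneq x k) => [->|ne_xk] /=.
  by rewrite ltnNge le_ik /= eqxx.
case: eqP => [|_]; first by do ?case: ifP; lia.
by congr NVar; do ?case: ifP; lia.
Qed.

Lemma nlift_nsubst_ge i k N M :
  k <= i -> nlift i (nsubst k N M) = nsubst k (nlift i N) (nlift i.+1 M).
Proof.
elim: M i k N => /= [x|M IH|M IHM P IHP|M IHM P IHP] i k N le_ki;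
  rewrite ?IHM ?IHP // ?IH ?nlift_nlift //.
case: (eqVneq x k) => [->|ne_xk] /=; first by rewrite ltnS le_ki eqxx.
case: eqP => [|_]; first by do ?case: ifP; lia.
by congr NVar; do ?case: ifP; lia.
Qed.

Lemma nsubst_nlift k N M : nsubst k N (nlift k M) = M.
Proof.
elim: M k N => /= [x|M IH|M IHM P IHP|M IHM P IHP] k N; rewrite ?IH ?IHM ?IHP //.
case: eqP => [|_]; first by case: ifP; lia.
by congr NVar; do ?case: ifP; lia.
Qed.

(** The substitution lemma. As [j <= k], the index [k] of the outer substitution reads [k.+1] as
    long as [j] has not been removed. *)
Lemma nsubst_nsubst j k L N M : j <= k ->
  nsubst k L (nsubst j N M) =
  nsubst j (nsubst k L N) (nsubst k.+1 (nlift j L) M).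
Proof.
elim: M j k L N => /= [x|M IH|M IHM P IHP|M IHM P IHP] j k L N le_jk.
- case: (eqVneq x j) => [->|ne_xj] /=.
    have -> : (j == k.+1) = false by lia.
    by rewrite ltnNge leqW //= eqxx.
  case: (eqVneq x k.+1) => [->|ne_xk].
    by rewrite ltnS le_jk /= eqxx nsubst_nlift.
  have -> : ((if j < x then x.-1 else x) == k) = false by case: ifP; lia.
  rewrite /=.
  have -> : ((if k.+1 < x then x.-1 else x) == j) = false by case: ifP; lia.
  by congr NVar; do ?case: ifP; lia.
- by rewrite IH // -nlift_nsubst_le // nlift_nlift.
- by rewrite IHM // IHP.
- by rewrite IHM // IHP.
Qed.

Lemma nd_eq_nlift k M N : nd_eq M N -> nd_eq (nlift k M) (nlift k N).
Proof.
move=> e; elim: e k => {M N} /=.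
- by move=> M k; apply: nd_refl.
- by move=> M N _ IH k; apply: nd_sym.
- by move=> M N P _ IH1 _ IH2 k; apply: nd_trans (IH1 k) (IH2 k).
- by move=> M M' _ IH k; apply: nd_lam.
- by move=> M M' N N' _ IH1 _ IH2 k; apply: nd_app.
- by move=> M M' N N' _ IH1 _ IH2 k; apply: nd_add.
- by move=> M N k; apply: nd_addC.
- by move=> M N P k; apply: nd_addA.
- by move=> M N k; apply: nd_lamD.
- by move=> M N P k; apply: nd_appD.
Qed.

Lemma nd_eq_nsubst k N M M' :
  nd_eq M M' -> nd_eq (nsubst k N M) (nsubst k N M').
Proof.
move=> e; elim: e k N => {M M'} /=.
- by move=> M k L; apply: nd_refl.
- by move=> M N _ IH k L; apply: nd_sym.
- by move=> M N P _ IH1 _ IH2 k L; apply: nd_trans (IH1 k L) (IH2 k L).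
- by move=> M M' _ IH k L; apply: nd_lam.
- by move=> M M' N N' _ IH1 _ IH2 k L; apply: nd_app.
- by move=> M M' N N' _ IH1 _ IH2 k L; apply: nd_add.
- by move=> M N k L; apply: nd_addC.
- by move=> M N P k L; apply: nd_addA.
- by move=> M N k L; apply: nd_lamD.
- by move=> M N P k L; apply: nd_appD.
Qed.

Lemma nd_eq_nsubstr k N N' M :
  nd_eq N N' -> nd_eq (nsubst k N M) (nsubst k N' M).
Proof.
elim: M k N N' => /= [x|M IH|M IHM P IHP|M IHM P IHP] k N N' e.
- by case: ifP => // _; apply: nd_refl.
- exact/nd_lam/IH/nd_eq_nlift.
- by apply: nd_app; [apply: IHM|apply: IHP].
- by apply: nd_add; [apply: IHM|apply: IHP].
Qed.

Lemma nd_beta_nlift k M N : nd_beta M N -> nd_beta (nlift k M) (nlift k N).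
Proof.
move=> r; elim: r k => {M N} /=; try by eauto using nd_beta.
by move=> M N k; rewrite nlift_nsubst_ge //; apply: nb_beta.
Qed.

Lemma nd_beta_nsubst k N M M' :
  nd_beta M M' -> nd_beta (nsubst k N M) (nsubst k N M').
Proof.
move=> r; elim: r k N => {M M'} /=; try by eauto using nd_beta.
by move=> M P k N; rewrite nsubst_nsubst //; apply: nb_beta.
Qed.

(** [N] is copied any number of times into [M], possibly none, and each copy takes its own step. *)
Lemma nd_beta_nsubstr k N N' M :
  nd_beta N N' -> star nd_beta (nsubst k N M) (nsubst k N' M).
Proof.
elim: M k N N' => /= [x|M IH|M IHM P IHP|M IHM P IHP] k N N' r.
- case: ifP => _; last exact: star_refl.
  exact: star1.
- by apply: (star_map nb_lam); apply: IH; apply: nd_beta_nlift.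
- apply: (@star_trans _ _ _ (NApp (nsubst k N' M) (nsubst k N P))).
  + by apply: (star_map (f := NApp^~ _)); [move=> *; apply: nb_appl|apply: IHM].
  + by apply: (star_map (f := NApp _)); [move=> *; apply: nb_appr|apply: IHP].
- apply: (@star_trans _ _ _ (NAdd (nsubst k N' M) (nsubst k N P))).
  + by apply: (star_map (f := NAdd^~ _)); [move=> *; apply: nb_addl|apply: IHM].
  + by apply: (star_map (f := NAdd _)); [move=> *; apply: nb_addr|apply: IHP].
Qed.

(** [weight M Qs n] weighs [M] applied to the stack [Qs]. An argument of a
    redex may be copied into all the summands produced by its body, whose
    number the weight [a] of the reduct bounds: hence [a * b.+1]. *)
Inductive weight : ndterm -> seq ndterm -> nat -> Prop :=
| weight_var0 i : weight (NVar i) [::] 1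
| weight_varS i Q Qs m n :
    weight Q [::] m -> weight (NVar i) Qs n -> weight (NVar i) (Q :: Qs) (m + n)
| weight_lam P n : weight P [::] n -> weight (NLam P) [::] n
| weight_beta P N Qs a b :
    weight (nsubst 0 N P) Qs a -> weight N [::] b ->
    weight (NLam P) (N :: Qs) (a * b.+1)
| weight_app M N Qs n : weight M (N :: Qs) n -> weight (NApp M N) Qs n
| weight_add M N Qs a b :
    weight M Qs a -> weight N Qs b -> weight (NAdd M N) Qs (a + b).

(** * Weights: determinism, invariance under [nd_eq], decrease under beta *)

Lemma weight_gt0 M Qs n : weight M Qs n -> 0 < n.
Proof. by elim=> {M Qs n} *; lia. Qed.

Lemma weightE M Qs n : weight M Qs n ->
  match M, Qs with
  | NVar i, [::] => n = 1
  | NVar i, Q :: Qs =>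
      exists a b, [/\ weight Q [::] a, weight (NVar i) Qs b & n = a + b]
  | NLam P, [::] => weight P [::] n
  | NLam P, N :: Qs =>
      exists a b, [/\ weight (nsubst 0 N P) Qs a, weight N [::] b & n = a * b.+1]
  | NApp M N, Qs => weight M (N :: Qs) n
  | NAdd M N, Qs => exists a b, [/\ weight M Qs a, weight N Qs b & n = a + b]
  end.
Proof. by case=> //= *; do 2?[eexists]; split; eauto. Qed.

Lemma weight_inj M Qs m n : weight M Qs m -> weight M Qs n -> m = n.
Proof.
move=> w; elim: w n => {M Qs m}.
- by move=> i n /weightE ->.
- by move=> i Q Qs m n _ IH1 _ IH2 p /weightE[a [b [/IH1 -> /IH2 -> ->]]].
- by move=> P m _ IH n /weightE /IH.
- by move=> P N Qs a b _ IH1 _ IH2 p /weightE[c [d [/IH1 -> /IH2 -> ->]]].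
- by move=> M N Qs m _ IH n /weightE /IH.
- by move=> M N Qs a b _ IH1 _ IH2 p /weightE[c [d [/IH1 -> /IH2 -> ->]]].
Qed.

Notation nd_eqs := (List.Forall2 nd_eq).

Lemma nd_eqs_refl Qs : nd_eqs Qs Qs.
Proof. by elim: Qs => *; constructor=> //; apply: nd_refl. Qed.

Lemma nd_eqs_sym Qs Qs' : nd_eqs Qs Qs' -> nd_eqs Qs' Qs.
Proof. by elim=> *; constructor=> //; apply: nd_sym. Qed.

(** Induction on the weight: arguments, reducts and summands weigh strictly less than [n]. Only the
    positions that keep the weight, under an abstraction with empty stack or in function position,
    rely on the induction on the congruence. Abstraction distributes over sums because
    [(c + d) * b.+1] splits. *)
Lemma weight_nd_eqs n M M' Qs Qs' :
  nd_eq M M' -> nd_eqs Qs Qs' -> weight M Qs n <-> weight M' Qs' n.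
Proof.
elim/ltn_ind: n M M' Qs Qs' => n IH M M' Qs Qs' e eQ.
have IH' m N N' Rs Rs' : m < n -> nd_eq N N' -> nd_eqs Rs Rs' ->
    weight N Rs m -> weight N' Rs' m.
  by move=> lt_mn e1 e2 w; apply/(IH _ lt_mn _ _ _ _ e1 e2).
(* [E] transports the fixed weight [n] in one direction; proving it both ways at once takes care of
   symmetry. *)
pose E N N' := forall Rs Rs', nd_eqs Rs Rs' -> weight N Rs n -> weight N' Rs' n.
have Evar i : E (NVar i) (NVar i).
  move=> Rs Rs' [|Q Q' {}Rs {}Rs' e1 e2] // /weightE[a [b [wa wb en]]].
  have := weight_gt0 wa; have := weight_gt0 wb => gt0 gt0'; rewrite en; constructor.
  - by apply: (IH' _ Q) => //; lia.
  - by apply: IH' wb => //; [lia|apply: nd_refl].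
have Elam P P' : nd_eq P P' -> E P P' -> E (NLam P) (NLam P').
  move=> eP EP Rs Rs' [|Q Q' {}Rs {}Rs' e1 e2].
    by move/weightE => w; constructor; apply: EP w; constructor.
  move/weightE => [a [b [wa wb en]]].
  have := weight_gt0 wa; have := weight_gt0 wb => gt0 gt0'; rewrite en; constructor.
  - apply: IH' wa => //; first by nia.
    by apply: nd_trans (nd_eq_nsubst _ _ eP) (nd_eq_nsubstr _ _ e1).
  - by apply: IH' wb => //; nia.
have Eapp P P' N N' : E P P' -> nd_eq N N' -> E (NApp P N) (NApp P' N').
  move=> EP eN Rs Rs' eR /weightE w.
  by constructor; apply: EP w; constructor.
have Eadd P P' N N' : nd_eq P P' -> nd_eq N N' -> E (NAdd P N) (NAdd P' N').
  move=> eP eN Rs Rs' eR /weightE[a [b [wa wb en]]].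
  have := weight_gt0 wa; have := weight_gt0 wb => gt0 gt0'.
  by rewrite en; constructor; [apply: IH' wa|apply: IH' wb] => //; lia.
have Erefl N : E N N.
  by elim: N => *; [apply: Evar|apply: Elam|apply: Eapp|apply: Eadd];
    try exact: nd_refl.
have Esame N N' : (forall Rs, weight N Rs n -> weight N' Rs n) -> E N N'.
  by move=> NN' Rs Rs' eR /NN'; apply: Erefl.
have {Evar} : E M M' /\ E M' M.
  elim: e => {M M'}.
  - by split; apply: Erefl.
  - by move=> M N _ [].
  - move=> M N P _ [E1 E2] _ [E3 E4]; split=> Rs Rs' eR.
    + by move/(E1 _ _ (nd_eqs_refl _)); apply: E3.
    + by move/(E4 _ _ (nd_eqs_refl _)); apply: E2.
  - by move=> M M' e [E1 E2]; split; apply: Elam => //; apply: nd_sym.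
  - by move=> M M' N N' _ [E1 E2] e _; split; apply: Eapp => //; apply: nd_sym.
  - by move=> M M' N N' e1 _ e2 _; split; apply: Eadd => //; apply: nd_sym.
  - have C M N : E (NAdd M N) (NAdd N M).
      apply: Esame => Rs /weightE[a [b [wa wb ->]]].
      by rewrite addnC; constructor.
    by [].
  - move=> M N P; split; apply: Esame => Rs /weightE[a [b [wa wb ->]]].
    + case/weightE: wa => [c [d [wc wd ->]]].
      by rewrite -addnA; do 2?constructor.
    + case/weightE: wb => [c [d [wc wd ->]]].
      by rewrite addnA; do 2?constructor.
  - move=> M N; split; apply: Esame => -[|Q Rs].
    + by move/weightE/weightE => [a [b [wa wb ->]]]; do 2?constructor.
    + move/weightE => [a [b [/weightE[c [d [wc wd ->]]] wb ->]]].
      by rewrite mulnDl; do 2?constructor.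
    + by move/weightE => [a [b [/weightE wa /weightE wb ->]]]; do 2?constructor.
    + move/weightE => [a [b [/weightE wa /weightE wb ->]]].
      case: wa wb => [c [d [wc wd ->]]] [c' [d' [wc' wd' ->]]].
      (* Both summands weigh the same argument [Q], so by determinism the two weights found for it
         agree. *)
      by rewrite (weight_inj wd' wd) -mulnDl; do 2?constructor.
  - move=> M N P; split; apply: Esame => Rs.
    + by move/weightE/weightE => [a [b [wa wb ->]]]; do 2?constructor.
    + by move/weightE => [a [b [/weightE wa /weightE wb ->]]]; do 2?constructor.
by case=> E1 E2; split; [apply: E1|apply: E2; apply: nd_eqs_sym].
Qed.

Inductive stack_beta : seq ndterm -> seq ndterm -> Prop :=
| sb_head Q Q' Qs : nd_beta Q Q' -> stack_beta (Q :: Qs) (Q' :: Qs)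
| sb_tail Q Qs Qs' : stack_beta Qs Qs' -> stack_beta (Q :: Qs) (Q :: Qs').

(** Lexicographic induction on the weight and on [M]. The second conjunct serves applications: their
    argument goes to the stack, and a step in it becomes a step of the stack. *)
Lemma weight_nd_beta n M Qs : weight M Qs n ->
  (forall M', nd_beta M M' -> exists2 m, m < n & weight M' Qs m) /\
  (forall Qs', stack_beta Qs Qs' -> exists2 m, m < n & weight M Qs' m).
Proof.
elim/ltn_ind: n M Qs => n IH.
have IHb m N N' : m < n -> weight N [::] m -> nd_beta N N' ->
    exists2 m', m' < m & weight N' [::] m'.
  by move=> lt_mn w r; case: (IH _ lt_mn _ _ w) => + _; apply.
have IHbs m N N' Qs : star nd_beta N N' -> m < n -> weight N Qs m ->
    exists2 m', m' <= m & weight N' Qs m'.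
  move=> r; elim: r m => {N N'} [N m|N P N' r _ IHr m] lt_mn w; first by exists m.
  have [+ _] := IH _ lt_mn _ _ w => /(_ _ r)[m' lt_m' w'].
  by have [|m2 le2 w2] := IHr _ _ w'; [lia|exists m2 => //; lia].
elim=> [i|P IHP|M IHM N _|M _ N _] Qs w.
- split=> [M' r|Qs' r]; first by inversion r.
  case: r w => [Q Q' {}Qs r|Q {}Qs {}Qs' r] /weightE[a [b [wa wb en]]].
  + have gt0 := weight_gt0 wb; have [|m' lt' w'] := IHb _ _ _ _ wa r; first by lia.
    by exists (m' + b); [lia|constructor].
  + have gt0 := weight_gt0 wa.
    have [|_ /(_ _ r)[m' lt' w']] := IH b _ _ _ wb; first by lia.
    by exists (a + m'); [lia|constructor].
- case: Qs w => [|Q Qs] /weightE.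
    move=> w; split=> [M' r|Qs' r]; last by inversion r.
    inversion r as [|P0 P' rP| | | |]; subst.
    have [+ _] := IHP _ w => /(_ _ rP)[m lt_mn w'].
    by exists m => //; constructor.
  move=> [a [b [wa wb en]]]; have gta := weight_gt0 wa; have gtb := weight_gt0 wb.
  have lt_a : a < n by nia.
  split=> [M' r|Qs' r].
  + inversion r as [|P0 P' rP| | | |]; subst.
    have [+ _] := IH _ lt_a _ _ wa.
    case/(_ _ (nd_beta_nsubst 0 Q rP)) => a' lt' w'.
    by exists (a' * b.+1); [nia|constructor].
  + inversion r as [Q0 Q' Qs0 rQ|Q0 Qs0 Qs1 rQ]; subst.
    * have [|b' lt_b wb'] := IHb b _ _ _ wb rQ; first by nia.
      have [a' le_a wa'] := IHbs _ _ _ _ (nd_beta_nsubstr 0 P rQ) lt_a wa.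
      by exists (a' * b'.+1); [nia|constructor].
    * have [_ /(_ _ rQ)[a' lt' w']] := IH _ lt_a _ _ wa.
      by exists (a' * b.+1); [nia|constructor].
- move/weightE in w; have [IH1 IH2] := IHM _ w.
  split=> [M' r|Qs' r].
  + inversion r as [P N0| |M0 M1 N0 rM|M0 N0 N' rN| |]; subst.
    * case/weightE: w => [a [b [wa wb en]]].
      have := weight_gt0 wa; have := weight_gt0 wb.
      by exists a => //; nia.
    * by have [m lt' w'] := IH1 _ rM; exists m => //; constructor.
    * have [m lt' w'] := IH2 _ (sb_head Qs rN).
      by exists m => //; constructor.
  + have [m lt' w'] := IH2 _ (sb_tail N r).
    by exists m => //; constructor.
- case/weightE: w => [a [b [wa wb en]]].
  have gta := weight_gt0 wa; have gtb := weight_gt0 wb.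
  have [|IH1 IH2] := IH a _ _ _ wa; first by lia.
  have [|IH3 IH4] := IH b _ _ _ wb; first by lia.
  split=> [M' r|Qs' r].
  + inversion r as [| | | |M0 M1 N0 rM|M0 N0 N' rN]; subst.
    * have [m lt' w'] := IH1 _ rM.
      by exists (m + b); [lia|constructor].
    * have [m lt' w'] := IH3 _ rN.
      by exists (a + m); [lia|constructor].
  + have [m lt' w'] := IH2 _ r; have [m2 lt2 w2] := IH4 _ r.
    by exists (m + m2); [lia|constructor].
Qed.

Lemma weight_strongly_normalizable M n :
  weight M [::] n -> strongly_normalizable M.
Proof.
move=> w [f [f0 fS]]; rewrite -{}f0 in w.
suff no i m : ~ weight (f i) [::] m by exact: no w.
elim/ltn_ind: m i => m IH i {}w.
have [M' [N' [eM r eN]]] := fS i.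
have /(weight_nd_eqs m eM (nd_eqs_refl _))/weight_nd_beta[+ _] := w.
case/(_ _ r) => m' lt_m' /(weight_nd_eqs m' eN (nd_eqs_refl _)).
exact: IH.
Qed.

(** * Differential substitution on ordered resource terms *)

(** The generated principle has no hypothesis on the elements of the argument list. *)
Lemma rtree_nested_ind (P : rtree -> Prop) :
  (forall i, P (RVar i)) -> (forall t, P t -> P (RLam t)) ->
  (forall s ts, P s -> {in ts, forall t, P t} -> P (RApp s ts)) ->
  forall t, P t.
Proof.
move=> Pvar Plam Papp; fix IH 1; case=> [i|t|s ts]; first exact: Pvar.
  exact/Plam/IH.
apply: Papp; first exact: IH.
elim: ts => [|u us IHus] t; first by clear IH; rewrite in_nil.
have {IH} Pu := IH u.
by rewrite in_cons => /predU1P[->|/IHus].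
Qed.

Lemma rlift_rlift i k t :
  i <= k -> rlift k.+1 (rlift i t) = rlift i (rlift k t).
Proof.
elim/rtree_nested_ind: t i k => [x|t IH|s ts IHs IHts] i k le_ik /=.
- by congr RVar; do ?case: ifP; lia.
- by rewrite IH.
- rewrite IHs // -!map_comp; congr RApp.
  by apply/eq_in_map => t /IHts; apply.
Qed.

Lemma map_rlift_rlift i k l : i <= k ->
  map (rlift k.+1) (map (rlift i) l) = map (rlift i) (map (rlift k) l).
Proof.
by move=> le_ik; rewrite -!map_comp; apply: eq_map => t /=; apply: rlift_rlift.
Qed.

(** The graph of [occ_subst], restricted to lists of the right size: permuting
    [l] is left to the reduction below. *)
Inductive osub : nat -> rtree -> seq rtree -> rtree -> Prop :=
| os_eq k n : osub k (RVar k) [:: n] n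
| os_neq k i : i != k -> osub k (RVar i) [::] (RVar (if k < i then i.-1 else i))
| os_lam k t l u : osub k.+1 t (map (rlift 0) l) u -> osub k (RLam t) l (RLam u)
| os_app k s ts l0 l1 s' ts' :
    osub k s l0 s' -> osubs k ts l1 ts' ->
    osub k (RApp s ts) (l0 ++ l1) (RApp s' ts')
with osubs : nat -> seq rtree -> seq rtree -> seq rtree -> Prop :=
| os_nil k : osubs k [::] [::] [::]
| os_cons k t ts l0 l1 t' ts' :
    osub k t l0 t' -> osubs k ts l1 ts' ->
    osubs k (t :: ts) (l0 ++ l1) (t' :: ts').

Scheme osub_mut := Minimality for osub Sort Prop
with osubs_mut := Minimality for osubs Sort Prop.
Combined Scheme osub_osubs_ind from osub_mut, osubs_mut.

Lemma osub_size k t l u : osub k t l u -> size l = nocc k t.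
Proof.
move: k t l u.
apply: (proj1 (osub_osubs_ind (P := fun k t l _ => size l = nocc k t)
  (P0 := fun k ts l _ => size l = sumn (map (nocc k) ts)) _ _ _ _ _ _)) => //=.
- by move=> k; rewrite eqxx.
- by move=> k i /negbTE ->.
- by move=> k t l u _; rewrite size_map.
- by move=> *; rewrite size_cat; congr addn.
- by move=> *; rewrite size_cat; congr addn.
Qed.

Lemma occ_subst_osub k t l :
  size l = nocc k t -> osub k t l (occ_subst k l t).
Proof.
elim/rtree_nested_ind: t k l => [x|t IH|s ts IHs IHts] k l /=.
- case: eqVneq => [->|ne]; last by case: l => //= _; apply: os_neq.
  by case: l => [|n []] //= _; apply: os_eq.
- by move=> e; constructor; apply: IH; rewrite size_map.
- move=> e; rewrite -{1}(cat_take_drop (nocc k s) l).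
  have e1 : size (take (nocc k s) l) = nocc k s by rewrite size_take; case: ifP; lia.
  constructor; first exact: IHs.
  have : size (drop (nocc k s) l) = sumn (map (nocc k) ts) by rewrite size_drop; lia.
  elim: ts (drop _ l) IHts {e e1} => [|t ts IH] {}l IHts /=.
    by move/size0nil ->; constructor.
  move=> e; rewrite -{1}(cat_take_drop (nocc k t) l).
  constructor.
    by apply: IHts; rewrite ?mem_head // size_take; case: ifP; lia.
  apply: IH; last by rewrite size_drop; lia.
  by move=> u uts; apply: IHts; rewrite in_cons uts orbT.
Qed.

Lemma osubE k t l u : osub k t l u ->
  match t with
  | RVar i => if i == k then l = [:: u]
              else l = [::] /\ u = RVar (if k < i then i.-1 else i)
  | RLam t => exists2 v, u = RLam v & osub k.+1 t (map (rlift 0) l) v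
  | RApp s ts => exists l0 l1 s' ts',
      [/\ l = l0 ++ l1, u = RApp s' ts', osub k s l0 s' & osubs k ts l1 ts']
  end.
Proof.
case=> {k t l u} [k n|k i /negbTE ->|k t l u H|k s ts l0 l1 s' ts' H1 H2] //.
- by rewrite eqxx.
- by exists u.
- by exists l0, l1, s', ts'.
Qed.

Lemma osubsE k ts l us : osubs k ts l us ->
  match ts with
  | [::] => l = [::] /\ us = [::]
  | t :: ts => exists l0 l1 t' ts',
      [/\ l = l0 ++ l1, us = t' :: ts', osub k t l0 t' & osubs k ts l1 ts']
  end.
Proof.
by case=> // {}k t {}ts l0 l1 t' ts' H1 H2; exists l0, l1, t', ts'.
Qed.

(** The occurrence counts fix the sizes of the pieces of [l], so it can be split in one way only. *)
Lemma osub_inj k t l u u' : osub k t l u -> osub k t l u' -> u = u'.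
Proof.
move=> H; move: k t l u H u'.
apply: (proj1 (osub_osubs_ind (P := fun k t l u => forall u', osub k t l u' -> u = u')
  (P0 := fun k ts l us => forall us', osubs k ts l us' -> us = us') _ _ _ _ _ _)).
- by move=> k n u /osubE; rewrite eqxx => -[].
- by move=> k i /negbTE ne u /osubE; rewrite ne => -[_ ->].
- by move=> k t l u _ IH u' /osubE[v -> /IH ->].
- move=> k s ts l0 l1 s' ts' os IHs oss IHts u /osubE[l2 [l3 [s2 [ts2 [/eqP]]]]].
  move=> + -> os2; rewrite eqseq_cat ?(osub_size os2) ?(osub_size os) //.
  case/andP=> /eqP ? /eqP ? oss2; subst.
  by rewrite (IHs _ os2) (IHts _ oss2).
- by move=> k us /osubsE[].
- move=> k s ts l0 l1 s' ts' os IHs oss IHts u /osubsE[l2 [l3 [s2 [ts2 [/eqP]]]]].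
  move=> + -> os2; rewrite eqseq_cat ?(osub_size os2) ?(osub_size os) //.
  case/andP=> /eqP ? /eqP ? oss2; subst.
  by rewrite (IHs _ os2) (IHts _ oss2).
Qed.

Lemma osub_total k t l : size l = nocc k t -> exists u, osub k t l u.
Proof. by move/occ_subst_osub; exists (occ_subst k l t). Qed.

(** * Lifting and composition of ordered substitutions *)

Lemma osub_rlift :
  (forall k t l u, osub k t l u -> forall i, k <= i ->
     osub k (rlift i.+1 t) (map (rlift i) l) (rlift i u)) /\
  (forall k ts l us, osubs k ts l us -> forall i, k <= i ->
     osubs k (map (rlift i.+1) ts) (map (rlift i) l) (map (rlift i) us)).
Proof.
apply: osub_osubs_ind => /=.
- by move=> k n i le; rewrite ifT ?ltnS //; apply: os_eq.
- move=> k x ne i le.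
  have -> : RVar (if (if k < x then x.-1 else x) < i
             then if k < x then x.-1 else x
             else (if k < x then x.-1 else x).+1) =
     RVar (if k < (if x < i.+1 then x else x.+1)
           then (if x < i.+1 then x else x.+1).-1
           else (if x < i.+1 then x else x.+1)).
    by congr RVar; do ?case: ifP; lia.
  by apply: os_neq; case: ifP; lia.
- move=> k t l u _ IH i le; constructor.
  by rewrite -map_rlift_rlift //; apply: IH.
- by move=> k s ts l0 l1 s' ts' _ IHs _ IHts i le; rewrite map_cat; constructor; auto.
- by constructor.
- by move=> k s ts l0 l1 s' ts' _ IHs _ IHts i le; rewrite map_cat; constructor; auto.
Qed.

Lemma osub_rlift_le :
  (forall k t l u, osub k t l u -> forall i, i <= k ->
     osub k.+1 (rlift i t) (map (rlift i) l) (rlift i u)) /\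
  (forall k ts l us, osubs k ts l us -> forall i, i <= k ->
     osubs k.+1 (map (rlift i) ts) (map (rlift i) l) (map (rlift i) us)).
Proof.
apply: osub_osubs_ind => /=.
- by move=> k n i le; rewrite ifN -?leqNgt //; apply: os_eq.
- move=> k x ne i le.
  have -> : RVar (if (if k < x then x.-1 else x) < i
             then if k < x then x.-1 else x
             else (if k < x then x.-1 else x).+1) =
     RVar (if k.+1 < (if x < i then x else x.+1)
           then (if x < i then x else x.+1).-1
           else (if x < i then x else x.+1)).
    by congr RVar; do ?case: ifP; lia.
  by apply: os_neq; case: ifP; lia.
- move=> k t l u _ IH i le; constructor.
  by rewrite -map_rlift_rlift //; apply: IH.
- by move=> k s ts l0 l1 s' ts' _ IHs _ IHts i le; rewrite map_cat; constructor; auto.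
- by constructor.
- by move=> k s ts l0 l1 s' ts' _ IHs _ IHts i le; rewrite map_cat; constructor; auto.
Qed.

Lemma osub_of_rlift k t : osub k (rlift k t) [::] t.
Proof.
elim/rtree_nested_ind: t k => [x|t IH|s ts IHs IHts] k /=.
- have -> : RVar x = RVar (if k < (if x < k then x else x.+1)
      then (if x < k then x else x.+1).-1 else (if x < k then x else x.+1)).
    by congr RVar; do ?case: ifP; lia.
  by apply: os_neq; case: ifP; lia.
- by constructor; apply: IH.
- apply: (@os_app _ _ _ [::] [::]); first exact: IHs.
  elim: ts IHts => [|t ts IH] IHts /=; first by constructor.
  apply: (@os_cons _ _ _ [::] [::]); first by apply: IHts; rewrite mem_head.
  by apply: IH => u uts; apply: IHts; rewrite in_cons uts orbT.
Qed.


Lemma nocc_rlift i k t : i <= k -> nocc k.+1 (rlift i t) = nocc k t.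
Proof.
elim/rtree_nested_ind: t i k => [x|t IH|s ts IHs IHts] i k le_ik /=.
- by congr nat_of_bool; case: ifP; lia.
- exact: IH.
- rewrite IHs // -map_comp; congr (_ + sumn _).
  by apply/eq_in_map => t /IHts; apply.
Qed.

(** The head variable [k.+1] differs from [k] and consumes nothing, so results on [osub] carry over
    to lists of arguments. *)
Lemma osubs_osub k ts l us :
  osubs k ts l us <-> osub k (RApp (RVar k.+1) ts) l (RApp (RVar k) us).
Proof.
have Hvar : osub k (RVar k.+1) [::] (RVar k).
  have -> : RVar k = RVar (if k < k.+1 then k.+1.-1 else k.+1) by rewrite ltnSn.
  by apply: os_neq; rewrite gtn_eqF.
split=> [H|]; first exact: (os_app Hvar H).
case/osubE => l0 [l1 [s' [ts' [-> [_ <-] /osub_size + H]]]].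
by rewrite /= gtn_eqF // => /size0nil ->.
Qed.

Lemma osubs_inj k ts l us us' : osubs k ts l us -> osubs k ts l us' -> us = us'.
Proof. by move=> /osubs_osub H /osubs_osub /(osub_inj H)[]. Qed.

Lemma osubs_size k ts l us :
  osubs k ts l us -> size l = sumn (map (nocc k) ts).
Proof. by move=> /osubs_osub /osub_size /=; rewrite gtn_eqF. Qed.

Lemma osubs_total k ts l :
  size l = sumn (map (nocc k) ts) -> exists us, osubs k ts l us.
Proof.
(* The dummy [RVar 0] is consumed by the head [RVar k] and leaves [l] to the arguments. *)
move=> e; have [|u] := @osub_total k (RApp (RVar k) ts) (RVar 0 :: l).
  by rewrite /= eqxx e.
case/osubE=> l0 [l1 [s' [ts' [e0 _ /osubE]]]]; rewrite eqxx => e1 H.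
by move: e0; rewrite e1 => -[_ ->]; exists ts'.
Qed.

Lemma osubs_cat k ts us l m ts' us' :
  osubs k ts l ts' -> osubs k us m us' -> osubs k (ts ++ us) (l ++ m) (ts' ++ us').
Proof.
move=> H1 H2; elim: ts l ts' H1 => [|t ts IH] l ts' /osubsE.
  by case=> -> ->.
case=> l0 [l1 [t' [ts2 [-> -> Ht Hts]]]]; rewrite -catA /=.
by constructor => //; apply: IH.
Qed.

Lemma osubs_catE k ts us l vs : osubs k (ts ++ us) l vs ->
  exists l0 l1 ts' us',
    [/\ l = l0 ++ l1, vs = ts' ++ us', osubs k ts l0 ts' & osubs k us l1 us'].
Proof.
elim: ts l vs => [|t ts IH] l vs /=.
  by move=> H; exists [::], l, [::], vs; split=> //; constructor.
case/osubsE => l0 [l1 [t' [vs' [-> -> Ht /IH]]]].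
case=> la [lb [ts' [us' [-> -> Hts Hus]]]].
by exists (l0 ++ la), lb, (t' :: ts'), us'; split; rewrite ?catA //; constructor.
Qed.

Lemma perm_cons_split (T : eqType) (x : T) s l :
  perm_eq (x :: s) l -> exists a b, l = a ++ x :: b /\ perm_eq s (a ++ b).
Proof.
move=> e; have xl : x \in l by rewrite -(perm_mem e) mem_head.
case/splitPr: xl e => a b e; exists a, b; split=> //.
by rewrite -(perm_cons x) (seq.permPl e) perm_catC /= perm_cons perm_catC.
Qed.

Lemma perm_map_ex (T U : eqType) (f : T -> U) l l' :
  perm_eq l (map f l') -> exists2 l2, l = map f l2 & perm_eq l2 l'.
Proof.
elim: l l' => [|x l IH] l'.
  by case: l' => [|y l'] e; [exists [::]|have := perm_size e].
case/perm_cons_split => a [b [e el]].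
have [a' [y [b' [ea ey]]]] : exists a' y b', a = map f a' /\
    [/\ x = f y, b = map f b' & l' = a' ++ y :: b'].
  clear IH; elim: l' a e {el} => [|z l' IHl'] [|u a] //= [ez e].
    by exists [::], z, l'; rewrite ez e.
  have [a' [y [b' [-> [-> -> ->]]]]] := IHl' _ e.
  by exists (z :: a'), y, b'; rewrite /= ez.
case: ey => ey eb el'; rewrite ea eb -map_cat in el.
have [l2 -> e2] := IH _ el; exists (y :: l2); first by rewrite ey.
by rewrite el' perm_sym perm_catC /= perm_cons perm_catC perm_sym.
Qed.

Ltac perm_count :=
  repeat match goal with
  | H : is_true (perm_eq _ _) |- _ => move/seq.permP: H => H
  end;
  apply/seq.permP; let p := fresh "p" in intro p;
  repeat match goal with
  | H : @eqfun _ _ _ _ |- _ => move: (H p); clear H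
  end;
  rewrite ?count_cat /= ?count_cat; lia.

Lemma map_cat_split (T U : eqType) (f : T -> U) l a b : map f l = a ++ b ->
  exists l1 l2, [/\ a = map f l1, b = map f l2 & l = l1 ++ l2].
Proof.
elim: l a => [|x l IH] [|y a] //= .
- by move=> <-; exists [::], [::].
- by move=> <-; exists [::], (x :: l).
- by case=> <- /IH[l1 [l2 [-> -> ->]]]; exists (x :: l1), l2.
Qed.

(** The substitution lemma for the graph. Each occurrence of [k] in [u] comes either from [q] or
    from an element of [m]; [l] is split accordingly into [l0] and [l1], up to a permutation since
    the two kinds interleave. *)
Lemma osub_osub :
  (forall j q m u, osub j q m u -> forall k l v, j <= k -> osub k u l v ->
     exists l0 l1 q' m',
       [/\ perm_eq l (l0 ++ l1), osub k.+1 q (map (rlift j) l0) q',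
           osubs k m l1 m' & osub j q' m' v]) /\
  (forall j q m u, osubs j q m u -> forall k l v, j <= k -> osubs k u l v ->
     exists l0 l1 q' m',
       [/\ perm_eq l (l0 ++ l1), osubs k.+1 q (map (rlift j) l0) q',
           osubs k m l1 m' & osubs j q' m' v]).
Proof.
apply: osub_osubs_ind.
- move=> j n k l v le_jk H.
  exists [::], l, (RVar j), [:: v]; split=> //; last exact: os_eq.
    have {2}-> : RVar j = RVar (if k.+1 < j then j.-1 else j) by rewrite ltnNge leqW.
    by apply: os_neq; lia.
  by rewrite -(cats0 l); apply: os_cons => //; constructor.
- move=> j i ne k l v le_jk /osubE; case: eqP => [ei ->|ne' [-> ->]].
    exists [:: v], [::], (rlift j v), [::]; split=> //; last exact: osub_of_rlift.
      have -> : i = k.+1 by move: ei; case: ifP; lia.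
      exact: os_eq.
    by constructor.
  exists [::], [::], (RVar (if k.+1 < i then i.-1 else i)), [::]; split=> //.
  + by apply: os_neq; move: ne'; case: ifP; lia.
  + by constructor.
  + have -> : RVar (if k < (if j < i then i.-1 else i)
             then (if j < i then i.-1 else i).-1
             else (if j < i then i.-1 else i)) =
       RVar (if j < (if k.+1 < i then i.-1 else i)
             then (if k.+1 < i then i.-1 else i).-1
             else (if k.+1 < i then i.-1 else i)).
      by congr RVar; do ?case: ifP; lia.
    by apply: os_neq; case: ifP; lia.
- move=> j q m u _ IH k l w le_jk /osubE[v -> H].
  have [|L0 [L1 [q' [M']]]] := IH k.+1 _ _ _ H; first by [].
  case=> e Hq Hm Hv.
  (* Under the binder the list is lifted; the permutation is pulled back along [rlift 0] to one of
     [l] itself. *)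
  have [l2 /esym/map_cat_split] :
      exists2 l2, L0 ++ L1 = map (rlift 0) l2 & perm_eq l2 l.
    by apply: perm_map_ex; rewrite perm_sym.
  case=> l0 [l1 [e0 e1 e2]]; rewrite {}e2 {}e0 {}e1 {L0 L1} in e Hq Hm * => el.
  (* The unlifted substitution exists by counting occurrences; uniqueness then identifies [M'] with
     the lift of [m']. *)
  have [m' Hm'] : exists m', osubs k m l1 m'.
    apply: osubs_total; rewrite -(size_map (rlift 0)) (osubs_size Hm) -map_comp.
    by congr sumn; apply: eq_map => t /=; apply: nocc_rlift.
  have eM := osubs_inj Hm (proj2 osub_rlift_le _ _ _ _ Hm' 0 (leq0n _)).
  exists l0, l1, (RLam q'), m'; split=> //.
  + by rewrite perm_sym.
  + by constructor; rewrite -map_rlift_rlift.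
  + by constructor; rewrite -eM.
- move=> j s ts m0 m1 s' ts' _ IHs _ IHts k l w le_jk.
  case/osubE => la [lb [s2 [ts2 [-> -> Hs Hts]]]].
  have [l0 [l1 [q [m [e1 H1 H2 H3]]]]] := IHs _ _ _ le_jk Hs.
  have [l0' [l1' [q' [m' [e1' H1' H2' H3']]]]] := IHts _ _ _ le_jk Hts.
  exists (l0 ++ l0'), (l1 ++ l1'), (RApp q q'), (m ++ m'); split.
  + by perm_count.
  + by rewrite map_cat; constructor.
  + exact: osubs_cat.
  + by constructor.
- move=> j k l v le_jk /osubsE[-> ->].
  by exists [::], [::], [::], [::]; split=> //; constructor.
- move=> j s ts m0 m1 s' ts' _ IHs _ IHts k l w le_jk.
  case/osubsE => la [lb [s2 [ts2 [-> -> Hs Hts]]]].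
  have [l0 [l1 [q [m [e1 H1 H2 H3]]]]] := IHs _ _ _ le_jk Hs.
  have [l0' [l1' [q' [m' [e1' H1' H2' H3']]]]] := IHts _ _ _ le_jk Hts.
  exists (l0 ++ l0'), (l1 ++ l1'), (q :: q'), (m ++ m'); split.
  + by perm_count.
  + by rewrite map_cat; constructor.
  + exact: osubs_cat.
  + by constructor.
Qed.

(** * Resource reduction on ordered terms and its factorization *)

(** Bags may be reordered, as they stand for multisets; the boolean [b] tells
    whether redexes may be fired. *)
Inductive red (b : bool) : rtree -> rtree -> Prop :=
| red_beta t l u : b -> osub 0 t l u -> red b (RApp (RLam t) l) u
| red_perm s l l' : perm_eq l l' -> red b (RApp s l) (RApp s l')
| red_lam t t' : red b t t' -> red b (RLam t) (RLam t')
| red_appl s s' l : red b s s' -> red b (RApp s l) (RApp s' l)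
| red_appr s l1 t t' l2 :
    red b t t' -> red b (RApp s (l1 ++ t :: l2)) (RApp s (l1 ++ t' :: l2)).

Lemma red_rlift b k t t' : red b t t' -> red b (rlift k t) (rlift k t').
Proof.
move=> r; elim: r k => {t t'} /=.
- move=> t l u Hb H k; apply: red_beta => //.
  by apply: (proj1 osub_rlift) H _ _.
- by move=> s l l' e k; apply: red_perm; apply: perm_map.
- by move=> t t' _ IH k; apply: red_lam.
- by move=> s s' l _ IH k; apply: red_appl.
- by move=> s l1 t t' l2 _ IH k; rewrite !map_cat /=; apply: red_appr.
Qed.

Lemma star_red_app b s s' l l' :
  star (red b) s s' -> List.Forall2 (star (red b)) l l' ->
  star (red b) (RApp s l) (RApp s' l').
Proof.
move=> rs rl.
apply: (@star_trans _ _ _ (RApp s' l)).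
  by apply: (star_map (f := RApp^~ l)) rs => *; apply: red_appl.
(* Generalizes the empty list to the prefix of arguments that are already reduced. *)
rewrite -[l]cat0s -[l']cat0s; move: [::].
elim: rl => {l l'} [|t t' l l' rt _ IH] p; first exact: star_refl.
apply: (@star_trans _ _ _ (RApp s' (p ++ t' :: l))).
  by apply: (star_map (f := fun t => RApp s' (p ++ t :: l))) rt => *; apply: red_appr.
by rewrite -!cat_rcons; apply: IH.
Qed.

Notation reds_bag b := (List.Forall2 (star (red b))).

Lemma reds_bag_refl b l : reds_bag b l l.
Proof. by elim: l => *; constructor=> //; apply: star_refl. Qed.

Lemma reds_bag_rlift b k l l' :
  reds_bag b l l' -> reds_bag b (map (rlift k) l) (map (rlift k) l').
Proof.
elim=> {l l'} /= [|t t' l l' r _ IH]; constructor=> //.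
by apply: star_map r => *; apply: red_rlift.
Qed.

Lemma Forall2_size T U (R : T -> U -> Prop) l l' :
  List.Forall2 R l l' -> size l = size l'.
Proof. by elim=> //= *; congr S. Qed.

Lemma Forall2_cat_inv T U (R : T -> U -> Prop) l1 l2 l1' l2' :
  size l1 = size l1' -> List.Forall2 R (l1 ++ l2) (l1' ++ l2') ->
  List.Forall2 R l1 l1' /\ List.Forall2 R l2 l2'.
Proof.
elim: l1 l1' => [|x l1 IH] [|x' l1'] //= [e] H; inversion H; subst.
by have [] := IH _ e H5; split=> //; constructor.
Qed.

(** Both results have the shape of the same [t], and each element of [l] lands at exactly one place,
    where it reduces independently. *)
Lemma osub_star_red b :
  (forall k t l u, osub k t l u -> forall l' u',
     reds_bag b l l' -> osub k t l' u' -> star (red b) u u') /\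
  (forall k ts l us, osubs k ts l us -> forall l' us',
     reds_bag b l l' -> osubs k ts l' us' -> reds_bag b us us').
Proof.
apply: osub_osubs_ind.
- move=> k n l' u' + /osubE; rewrite eqxx => + e; rewrite {}e => H.
  by inversion H.
- by move=> k i /negbTE ne l' u' _ /osubE; rewrite ne => -[_ ->]; apply: star_refl.
- move=> k t l u _ IH l' u' rl /osubE[v -> H].
  by apply: (star_map (@red_lam b)); apply: IH H; apply: reds_bag_rlift.
- move=> k s ts l0 l1 s' ts' Hs IHs Hts IHts l' u' rl.
  case/osubE=> l0' [l1' [s2 [ts2 [e -> Hs2 Hts2]]]]; rewrite {}e in rl.
  have [|r0 r1] := Forall2_cat_inv _ rl.
    by rewrite (osub_size Hs) (osub_size Hs2).
  by apply: star_red_app; [apply: IHs Hs2|apply: IHts Hts2].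
- by move=> k l us _ /osubsE[_ ->]; constructor.
- move=> k s ts l0 l1 s' ts' Hs IHs Hts IHts l' u' rl.
  case/osubsE=> l0' [l1' [s2 [ts2 [e -> Hs2 Hts2]]]]; rewrite {}e in rl.
  have [|r0 r1] := Forall2_cat_inv _ rl.
    by rewrite (osub_size Hs) (osub_size Hs2).
  by constructor; [apply: IHs Hs2|apply: IHts Hts2].
Qed.

Lemma osub_reds_bag b k t l l' u' :
  reds_bag b l l' -> osub k t l' u' ->
  exists2 u, osub k t l u & star (red b) u u'.
Proof.
move=> rl H; have [|u Hu] := @osub_total k t l.
  by rewrite (Forall2_size rl) (osub_size H).
by exists u => //; apply: (proj1 (osub_star_red b)) Hu _ _ rl H.
Qed.

Lemma osubs_perm k ts ts' l us :
  perm_eq ts ts' -> osubs k ts' l us ->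
  exists l' us', [/\ perm_eq l l', osubs k ts l' us' & perm_eq us' us].
Proof.
elim: ts ts' l us => [|t ts IH] ts' l us.
  case: ts' => [|u ts'] e; last by have := perm_size e.
  by case/osubsE => -> ->; exists [::], [::]; split=> //; constructor.
case/perm_cons_split => a [b [-> e]] /osubs_catE.
case=> la [lb [va [vb [-> -> Ha /osubsE]]]].
case=> lt [lc [vt [vc [-> -> Ht Hc]]]].
have [l' [us' [e1 H e2]]] := IH _ _ _ e (osubs_cat Ha Hc).
exists (lt ++ l'), (vt :: us'); split.
- by clear -e1; perm_count.
- by constructor.
- by clear -e2; perm_count.
Qed.

(** A substitution performed after a step is moved before it. The step may displace the occurrences
    of [k], by reordering a bag or by firing a redex, hence the permutation of [l]. *)
Lemma red_osub b t t' k l u' : red b t t' -> osub k t' l u' ->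
  exists l' u, [/\ perm_eq l l', osub k t l' u & star (red b) u u'].
Proof.
move=> r; elim: r k l u' => {t t'}.
- move=> t m u Hb H k l v Hv.
  have [l0 [l1 [t' [m' [e H1 H2 H3]]]]] := proj1 osub_osub _ _ _ _ H _ _ _ (leq0n k) Hv.
  exists (l0 ++ l1), (RApp (RLam t') m'); split=> //.
    by constructor=> //; constructor.
  by apply: star1; apply: red_beta.
- move=> s m m' e k l v /osubE[l0 [l1 [s' [us [-> -> Hs Hm']]]]].
  have [l' [us' [e1 H e2]]] := osubs_perm e Hm'.
  exists (l0 ++ l'), (RApp s' us'); split; first by rewrite perm_cat2l.
    by constructor.
  by apply: star1; apply: red_perm.
- move=> t t' _ IH k l v /osubE[u -> /IH[l' [u' [e H r]]]].
  move: e; rewrite perm_sym => /perm_map_ex[l2 e e2]; rewrite {}e in H.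
  exists l2, (RLam u'); split; [by rewrite perm_sym|by constructor|].
  exact: (star_map (@red_lam b)).
- move=> s s' m _ IH k l v /osubE[l0 [l1 [s2 [us [-> -> /IH[l' [u [e H r]]] Hm]]]]].
  exists (l' ++ l1), (RApp u us); split; [by rewrite perm_cat2r|by constructor|].
  by apply: star_red_app => //; apply: reds_bag_refl.
- move=> s m1 t t' m2 _ IH k l v /osubE[l0 [l1 [s2 [us [-> -> Hs]]]]].
  case/osubs_catE=> la [lb [va [vb [-> -> Ha /osubsE]]]].
  case=> lt [lc [vt [vc [-> -> /IH[l' [u [e H r]]] Hc]]]].
  exists (l0 ++ (la ++ l' ++ lc)), (RApp s2 (va ++ u :: vc)); split.
  + by clear -e; perm_count.
  + by constructor=> //; apply: osubs_cat => //; constructor.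
  + apply: (star_map (f := fun u => RApp s2 (va ++ u :: vc))) r => *.
    exact: red_appr.
Qed.

Lemma star_red_osub b t t' k l u' : star (red b) t t' -> osub k t' l u' ->
  exists l' u, [/\ perm_eq l l', osub k t l' u & star (red b) u u'].
Proof.
move=> r; elim: r l u' => {t t'} [t|t1 t2 t3 r _ IH] l u' H.
  by exists l, u'; split=> //; apply: star_refl.
have [l2 [u2 [e2 H2 r2]]] := IH _ _ H.
have [l1 [u1 [e1 H1 r1]]] := red_osub r H2.
by exists l1, u1; split=> //; [apply: perm_trans e2 e1|apply: star_trans r1 r2].
Qed.

(** * Head reduction and its commutation with other steps *)

Inductive hred : rtree -> rtree -> Prop :=
| hred_beta t l l' u :
    perm_eq l l' -> osub 0 t l' u -> hred (RApp (RLam t) l) u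
| hred_app s s' l : hred s s' -> hred (RApp s l) (RApp s' l).

Lemma hred_red t u : hred t u -> star (red true) t u.
Proof.
elim=> {t u} [t l l' u e H|s s' l _ IH].
  by apply: star_step (red_perm _ _ e) _; apply/star1/red_beta.
by apply: (star_map (f := RApp^~ l)) IH => *; apply: red_appl.
Qed.

(** Either the first step fires a redex on the head path, and is a head step itself, or the head
    redex is already present in [t]: it is fired first, and the other step is redone on the result.
    Reorderings of its bag are absorbed by [hred_beta]. *)
Lemma red_hred t t' u' : red true t t' -> hred t' u' ->
  exists2 u, hred t u & star (red true) u u'.
Proof.
move=> r; elim: r u' => {t t'}.
- move=> t l u _ H u' h; exists u; last exact: hred_red.
  exact: hred_beta H.
- move=> s l l' e u' h; inversion h as [t m l2 v e2 H|s0 s' m h']; subst.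
    by exists u'; [apply: hred_beta H; apply: perm_trans e e2|apply: star_refl].
  by exists (RApp s' l); [apply: hred_app|apply/star1/red_perm].
- by move=> t t' _ _ u' h; inversion h.
- move=> s s' l r IH u' h; inversion h as [t m l2 v e2 H|s0 s2 m h']; subst.
    inversion r as [t0 m u _ H0| |t0 t1 r0| |]; subst.
    + exists (RApp (RLam t) l); first by apply: hred_app; apply: hred_beta H0.
      by apply: hred_red; apply: hred_beta H.
    + have [l' [u [e' H' r']]] := red_osub r0 H.
      by exists u => //; apply: hred_beta H'; apply: perm_trans e2 e'.
  have [u h2 r2] := IH _ h'; exists (RApp u l); first exact: hred_app.
  by apply: (star_map (f := RApp^~ l)) r2 => *; apply: red_appl.
- move=> s l1 t t' l2 r IH u' h; inversion h as [q m l' v e H|s0 s2 m h']; subst.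
    have [a [b [e' e2]]] : exists a b, l' = a ++ t' :: b /\ perm_eq (l1 ++ l2) (a ++ b).
      by apply: perm_cons_split; apply: perm_trans e; clear; perm_count.
    rewrite {}e' in e H.
    have [|u Hu ru] := @osub_reds_bag true 0 q (a ++ t :: b) _ _ _ H.
      apply: List.Forall2_app; first exact: reds_bag_refl.
      by constructor; [apply: star1|apply: reds_bag_refl].
    exists u => //; apply: hred_beta Hu.
    by clear -e2; perm_count.
  by exists (RApp s2 (l1 ++ t :: l2)); [apply: hred_app|apply/star1/red_appr].
Qed.

(** Induction on the reduction: a head step found later is moved to the front by [red_hred]. Without
    one, the function and the arguments reduce separately and the number of arguments is kept. *)
Lemma star_red_app_inv s l v : star (red true) (RApp s l) v ->
  (exists s' l', [/\ v = RApp s' l', star (red true) s s', size l = size l' &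
     {in l, forall t, exists2 t', t' \in l' & star (red true) t t'}]) \/
  (exists2 u, hred (RApp s l) u & star (red true) u v).
Proof.
move Et : (RApp s l) => t r; elim: r s l Et => {t v} [t|t t2 v r rv IH] s l Et.
  left; exists s, l; rewrite Et; split=> //; first exact: star_refl.
  by move=> x xl; exists x => //; apply: star_refl.
subst t; inversion r
  as [q m u _ H|s0 m m' e|q q' r0|s0 s' m r0|s0 m1 q q' m2 r0]; subst.
- by right; exists t2 => //; apply: hred_beta H.
- have [[s' [l' [-> rs el rl]]]|[u h ru]] := IH _ _ erefl.
    left; exists s', l'; split=> //; first by rewrite (perm_size e).
    by move=> x; rewrite (perm_mem e); apply: rl.
  have [u' h' ru'] := red_hred r h.
  by right; exists u' => //; apply: star_trans ru' ru.
- have [[s2 [l' [-> rs el rl]]]|[u h ru]] := IH _ _ erefl.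
    by left; exists s2, l'; split=> //; apply: star_step r0 rs.
  have [u' h' ru'] := red_hred r h.
  by right; exists u' => //; apply: star_trans ru' ru.
- have [[s2 [l' [-> rs el rl]]]|[u h ru]] := IH _ _ erefl.
    left; exists s2, l'; split=> //; first by rewrite -el !size_cat.
    move=> x; rewrite mem_cat in_cons => /or3P[x1|/eqP->|x2].
    + by apply: rl; rewrite mem_cat x1.
    + have [|x' x'l rx] := rl q'; first by rewrite mem_cat mem_head orbT.
      by exists x' => //; apply: star_step r0 rx.
    + by apply: rl; rewrite mem_cat in_cons x2 !orbT.
  have [u' h' ru'] := red_hred r h.
  by right; exists u' => //; apply: star_trans ru' ru.
Qed.

Lemma star_red_lam_inv b t v : star (red b) (RLam t) v ->
  exists2 t', v = RLam t' & star (red b) t t'.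
Proof.
move Eu : (RLam t) => u r; elim: r t Eu => {u v} [u|u u2 v r rv IH] t Eu.
  by exists t => //; apply: star_refl.
subst u; inversion r as [| |q q' r0| |]; subst.
by have [t' -> r'] := IH _ erefl; exists t' => //; apply: star_step r0 r'.
Qed.

(** * Sizes under substitution and head steps *)

Fixpoint tree_size (t : rtree) : nat :=
  match t with
  | RVar _ => 1
  | RLam t => (tree_size t).+1
  | RApp s ts => (tree_size s + sumn (map tree_size ts)).+1
  end.

Lemma tree_size_gt0 t : 0 < tree_size t.
Proof. by case: t. Qed.

Lemma tree_size_rlift k t : tree_size (rlift k t) = tree_size t.
Proof.
elim/rtree_nested_ind: t k => [x|t IH|s ts IHs IHts] k //=; first by rewrite IH.
by rewrite IHs -map_comp; congr (_ + sumn _).+1; apply/eq_in_map => t /IHts; apply.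
Qed.

(** Each element of [l] replaces one variable, of size 1; the additive form avoids subtraction. *)
Lemma osub_tree_size :
  (forall k t l u, osub k t l u ->
     tree_size u + size l = tree_size t + sumn (map tree_size l)) /\
  (forall k ts l us, osubs k ts l us ->
     sumn (map tree_size us) + size l =
     sumn (map tree_size ts) + sumn (map tree_size l)).
Proof.
apply: osub_osubs_ind => //=.
- by move=> k n; lia.
- move=> k t l u _; rewrite size_map -map_comp.
  by rewrite (eq_map (g := tree_size)) => [|x]; [lia|apply: tree_size_rlift].
- by move=> k s ts l0 l1 s' ts' _ IH1 _ IH2; rewrite size_cat map_cat sumn_cat; lia.
- by move=> k s ts l0 l1 s' ts' _ IH1 _ IH2; rewrite size_cat map_cat sumn_cat; lia.
Qed.

Lemma size_le_tree_size l : size l <= sumn (map tree_size l).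
Proof. by elim: l => //= t l; have := tree_size_gt0 t; lia. Qed.

Lemma osub_tree_size_lt t l u :
  osub 0 t l u -> tree_size u < tree_size (RApp (RLam t) l).
Proof. by move/(proj1 osub_tree_size) => /=; lia. Qed.

Lemma perm_tree_size l l' :
  perm_eq l l' -> sumn (map tree_size l) = sumn (map tree_size l').
Proof. by move=> e; apply: perm_sumn; apply: perm_map. Qed.

Lemma nocc_le_tree_size k t : nocc k t <= tree_size t.
Proof.
elim/rtree_nested_ind: t k => [x|t IH|s ts IHs IHts] k /=.
- exact: leq_b1.
- exact: leqW.
- apply: leqW; apply: leq_add => //.
  elim: ts IHts => //= t ts IH IHts; apply: leq_add; first by rewrite IHts ?mem_head.
  by apply: IH => u uts; apply: IHts; rewrite in_cons uts orbT.
Qed.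

(** The size of [u] is that of the body plus that of the bag minus the cardinality of the bag. This
    cardinality is at most the size of the bag and, counting occurrences, at most that of the body;
    so [u] is at least as large as either. The 2 counts the application and the abstraction. *)
Lemma hred_tree_size t u : hred t u -> tree_size t <= (tree_size u).*2 + 2.
Proof.
elim=> {t u} /= [t l l' u e H|s s' l _ IH]; last by lia.
have := proj1 osub_tree_size _ _ _ _ H; have := size_le_tree_size l'.
rewrite (perm_tree_size e).
by have := nocc_le_tree_size 0 t; rewrite -(osub_size H); lia.
Qed.

(** * Taylor expansion by ordered terms *)

(** A predicate on raw trees, canonical or not: it asks only which arguments occur, and is
    insensitive to their order. *)
Fixpoint taylor_tree (M : ndterm) (t : rtree) : Prop :=
  match M, t with
  | NVar i, RVar j => i = j
  | NLam M, RLam t => taylor_tree M t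
  | NApp M N, RApp s ts => taylor_tree M s /\ {in ts, forall t, taylor_tree N t}
  | NAdd M N, t => taylor_tree M t \/ taylor_tree N t
  | _, _ => False
  end.

Lemma taylor_tree_nlift k N t : taylor_tree N t -> taylor_tree (nlift k N) (rlift k t).
Proof.
elim: N k t => [i|N IH|M IHM N IHN|M IHM N IHN] k t /=.
- by case: t => //= j ->.
- by case: t => //= t; apply: IH.
- case: t => //= s ts [sM tsN]; split; first exact: IHM.
  by move=> _ /mapP[t tts ->]; apply: IHN; apply: tsN.
- by case=> H; [left; apply: IHM|right; apply: IHN].
Qed.

Lemma map_preimage_ex (P : rtree -> Prop) (f : rtree -> rtree) l :
  {in l, forall t, exists2 t0, t = f t0 & P t0} ->
  exists2 l0, l = map f l0 & {in l0, forall t, P t}.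
Proof.
elim: l => [|t l IH] H; first by exists [::].
have [|l0 -> Hl0] := IH; first by move=> u ul; apply: H; rewrite in_cons ul orbT.
have [t0 -> Pt0] := H t (mem_head _ _); exists (t0 :: l0) => // u.
by rewrite in_cons => /predU1P[->|/Hl0].
Qed.

Lemma taylor_tree_nlift_inv k N t :
  taylor_tree (nlift k N) t -> exists2 t0, t = rlift k t0 & taylor_tree N t0.
Proof.
elim: N k t => [i|N IH|M IHM N IHN|M IHM N IHN] k t /=.
- by case: t => //= j <-; exists (RVar i).
- by case: t => //= t /IH[t0 -> H]; exists (RLam t0).
- case: t => //= s ts [/IHM[s0 -> sM] tsN].
  have [|l0 -> H] := @map_preimage_ex (taylor_tree N) (rlift k) ts.
    by move=> t /tsN/IHN.
  by exists (RApp s0 l0).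
- by case=> [/IHM|/IHN] [t0 -> H]; exists t0 => //; [left|right].
Qed.

Lemma in_cat_forall (T : eqType) (P : T -> Prop) (l1 l2 : seq T) :
  {in l1 ++ l2, forall t, P t} <->
  {in l1, forall t, P t} /\ {in l2, forall t, P t}.
Proof.
split=> [H|[H1 H2] t].
  by split=> t tl; apply: H; rewrite mem_cat tl ?orbT.
by rewrite mem_cat => /orP[/H1|/H2].
Qed.

Lemma in_cons_forall (T : eqType) (P : T -> Prop) (x : T) l :
  {in x :: l, forall t, P t} <-> P x /\ {in l, forall t, P t}.
Proof.
split=> [H|[H1 H2] t].
  by split=> [|t tl]; apply: H; rewrite ?mem_head // in_cons tl orbT.
by rewrite in_cons => /predU1P[->|/H2].
Qed.

Lemma taylor_tree_osub M N k t l u :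
  taylor_tree M t -> {in l, forall t, taylor_tree N t} ->
  osub k t l u -> taylor_tree (nsubst k N M) u.
Proof.
elim: M N k t l u => [i|M IH|M IHM P IHP|M IHM P IHP] N k t l u /=.
- case: t => //= _ <- Nl /osubE; case: eqP => [_ e|_ [_ ->]] //.
  by apply: Nl; rewrite e mem_head.
- case: t => //= t Mt Nl /osubE[v -> H]; apply: IH Mt _ H.
  by move=> _ /mapP[x xl ->]; apply: taylor_tree_nlift; apply: Nl.
- case: t => //= s ts [Ms Pts] Nl /osubE[l0 [l1 [s' [ts' [e -> Hs Hts]]]]].
  move: Nl; rewrite {}e => /in_cat_forall[Nl0 Nl1].
  split; first exact: IHM Hs.
  elim: ts l1 ts' Hts Pts Nl1 => [|t ts IH] l1 ts' /osubsE; first by case=> _ ->.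
  case=> la [lb [t' [ts2 [-> -> Ht Hts]]]].
  move=> /in_cons_forall[Pt Pts] /in_cat_forall[Na Nb].
  by apply/in_cons_forall; split; [apply: IHP Ht|apply: IH Hts _ _].
- by move=> [Mt|Pt] Nl H; [left; apply: IHM H|right; apply: IHP H].
Qed.

(** Each copy of [N] contributes its own component of [u] to [l]. With [taylor_tree_osub], the
    expansion of a substitution consists exactly of differential substitutions. *)
Lemma taylor_tree_osub_inv M N k u : taylor_tree (nsubst k N M) u ->
  exists t l, [/\ taylor_tree M t, {in l, forall t, taylor_tree N t} & osub k t l u].
Proof.
elim: M N k u => [i|M IH|M IHM P IHP|M IHM P IHP] N k u /=.
- case: (eqVneq i k) => [->|ne] H.
    exists (RVar k), [:: u]; split=> //; last exact: os_eq.
    by move=> t; rewrite inE => /eqP->.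
  case: u H => //= j <-; exists (RVar i), [::]; split=> //; exact: os_neq.
- case: u => //= u /IH[t [l [Mt Nl H]]].
  have [|l0 e Nl0] := @map_preimage_ex (taylor_tree N) (rlift 0) l.
    by move=> x /Nl/taylor_tree_nlift_inv.
  by exists (RLam t), l0; split=> //; constructor; rewrite -e.
- case: u => //= s ts [/IHM[s0 [l0 [Ms0 Nl0 Hs]]] Pts].
  have [ts0 [l1 [Pts0 Nl1 Hts]]] : exists ts0 l1, [/\
      {in ts0, forall t, taylor_tree P t},
      {in l1, forall t, taylor_tree N t} & osubs k ts0 l1 ts].
    elim: ts Pts => [|t ts IH]; first by exists [::], [::]; split=> //; constructor.
    case/in_cons_forall=> /IHP[t0 [l1 [Pt Nl1 Ht]]] /IH[ts0 [l2 [Pts Nl2 Hts]]].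
    exists (t0 :: ts0), (l1 ++ l2); split; last by constructor.
      exact/in_cons_forall.
    exact/in_cat_forall.
  exists (RApp s0 ts0), (l0 ++ l1); split=> //; last by constructor.
  exact/in_cat_forall.
- case=> [/IHM|/IHP] [t [l [Mt Nl H]]]; exists t, l; split=> //; by [left|right].
Qed.

Lemma taylor_tree_linear M : exists2 t, taylor_tree M t & all_bag_sizes (pred1 1) t.
Proof.
elim: M => [i|M [t Mt lt]|M [s Ms ls] N [t Nt lt]|M [t Mt lt] N _].
- by exists (RVar i).
- by exists (RLam t).
- exists (RApp s [:: t]); last by rewrite /= ls lt.
  by split=> // u; rewrite inE => /eqP->.
- by exists t => //; left.
Qed.

Fixpoint lam_bodies (M : ndterm) : seq ndterm :=
  match M with
  | NLam M => [:: M]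
  | NAdd M N => lam_bodies M ++ lam_bodies N
  | _ => [::]
  end.

(** A head redex is fired in one summand only, the other ones being dropped. *)
Fixpoint head_reducts (M : ndterm) : seq ndterm :=
  match M with
  | NApp M N =>
      [seq NApp M' N | M' <- head_reducts M]
      ++ [seq nsubst 0 N P | P <- lam_bodies M]
  | NAdd M N => head_reducts M ++ head_reducts N
  | _ => [::]
  end.

Lemma taylor_tree_lam_bodies M t :
  taylor_tree M (RLam t) -> exists2 P, List.In P (lam_bodies M) & taylor_tree P t.
Proof.
elim: M => //= [M _ Mt|M IHM N IHN]; first by exists M => //; left.
by case=> [/IHM|/IHN] [P inP Pt]; exists P => //; apply/List.in_or_app; [left|right].
Qed.

(** A resource term selects one summand at each sum on its head path, which determines the head
    redex of [M] to be fired. *)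
Lemma taylor_tree_hred M t u : taylor_tree M t -> hred t u ->
  exists2 M', List.In M' (head_reducts M) & taylor_tree M' u.
Proof.
elim: M t u => /= [i|M IH|M IHM N IHN|M IHM N IHN] t u.
- by move=> + h; case: h.
- by move=> + h; case: h.
- move=> + h; case: h => [p l l' v e H|s s' l h] [Ms Nl].
    have [P inP Pp] := taylor_tree_lam_bodies Ms.
    exists (nsubst 0 N P).
      by apply/List.in_or_app; right; apply: List.in_map.
    by apply: taylor_tree_osub Pp _ H => x; rewrite -(perm_mem e); apply: Nl.
  have [M' inM' M's'] := IHM _ _ Ms h.
  exists (NApp M' N); last by [].
  by apply/List.in_or_app; left; apply: (List.in_map (NApp^~ N)).
- case=> [Mt|Nt] h.
    by have [M' inM' ?] := IHM _ _ Mt h; exists M' => //; apply/List.in_or_app; left.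
  by have [M' inM' ?] := IHN _ _ Nt h; exists M' => //; apply/List.in_or_app; right.
Qed.

(** * Steps, subterms and summands modulo [nd_eq] *)

Lemma nd_step_refine M M' N' N :
  nd_eq M M' -> nd_step M' N' -> nd_eq N' N -> nd_step M N.
Proof.
move=> e1 [P [Q [e2 r e3]]] e4.
by exists P, Q; split=> //; [apply: nd_trans e1 e2|apply: nd_trans e3 e4].
Qed.

Lemma nd_step_context (f : ndterm -> ndterm) :
  (forall M N, nd_eq M N -> nd_eq (f M) (f N)) ->
  (forall M N, nd_beta M N -> nd_beta (f M) (f N)) ->
  forall M N, nd_step M N -> nd_step (f M) (f N).
Proof.
by move=> fe fb M N [P [Q [e1 r e2]]]; exists (f P), (f Q); split; auto.
Qed.

Lemma nd_step_beta M N : nd_beta M N -> nd_step M N.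
Proof. by move=> r; exists M, N; split=> //; apply: nd_refl. Qed.

Lemma nd_step_lam M N : nd_step M N -> nd_step (NLam M) (NLam N).
Proof. by apply: nd_step_context => *; by constructor. Qed.

Lemma nd_step_appl P M N : nd_step M N -> nd_step (NApp M P) (NApp N P).
Proof.
apply: (nd_step_context (f := NApp^~ P)) => *; last exact: nb_appl.
by apply: nd_app => //; apply: nd_refl.
Qed.

Lemma nd_step_appr P M N : nd_step M N -> nd_step (NApp P M) (NApp P N).
Proof.
apply: (nd_step_context (f := NApp P)) => *; last exact: nb_appr.
by apply: nd_app => //; apply: nd_refl.
Qed.

Lemma nd_step_addl P M N : nd_step M N -> nd_step (NAdd M P) (NAdd N P).
Proof.
apply: (nd_step_context (f := NAdd^~ P)) => *; last exact: nb_addl.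
by apply: nd_add => //; apply: nd_refl.
Qed.

Lemma nd_step_addr P M N : nd_step M N -> nd_step (NAdd P M) (NAdd P N).
Proof.
apply: (nd_step_context (f := NAdd P)) => *; last exact: nb_addr.
by apply: nd_add => //; apply: nd_refl.
Qed.


(** Subterms are taken modulo [nd_eq] at every stage. *)
Inductive emb (M : ndterm) : ndterm -> Prop :=
| emb_refl : emb M M
| emb_eq N N' : emb M N -> nd_eq N N' -> emb M N'
| emb_lam P : emb M (NLam P) -> emb M P
| emb_appl P Q : emb M (NApp P Q) -> emb M P
| emb_appr P Q : emb M (NApp P Q) -> emb M Q
| emb_addl P Q : emb M (NAdd P Q) -> emb M P
| emb_addr P Q : emb M (NAdd P Q) -> emb M Q.

Lemma emb_trans M N P : emb M N -> emb N P -> emb M P.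
Proof.
move=> eMN; elim=> {P} //.
- by move=> P Q _ IH; apply: emb_eq.
- by move=> P _; apply: emb_lam.
- by move=> P Q _; apply: emb_appl.
- by move=> P Q _; apply: emb_appr.
- by move=> P Q _; apply: emb_addl.
- by move=> P Q _; apply: emb_addr.
Qed.

(** Contexts preserve steps, and [nd_step] absorbs the congruences inserted between them. *)
Lemma emb_step M N N' : emb M N -> nd_step N N' ->
  exists2 M', nd_step M M' & emb M' N'.
Proof.
move=> e; elim: e N' => {N}.
- by move=> N r; exists N => //; apply: emb_refl.
- by move=> N P _ IH eNP P' r; apply: IH; apply: nd_step_refine eNP r (nd_refl _).
- move=> P _ IH P' /nd_step_lam/IH[M' r e]; exists M' => //; exact: emb_lam e.
- move=> P Q _ IH P' /(nd_step_appl Q)/IH[M' r e]; exists M' => //; exact: emb_appl e.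
- move=> P Q _ IH P' /(nd_step_appr P)/IH[M' r e]; exists M' => //; exact: emb_appr e.
- move=> P Q _ IH P' /(nd_step_addl Q)/IH[M' r e]; exists M' => //; exact: emb_addl e.
- move=> P Q _ IH P' /(nd_step_addr P)/IH[M' r e]; exists M' => //; exact: emb_addr e.
Qed.

Fixpoint nd_size (M : ndterm) : nat :=
  match M with
  | NVar _ => 1
  | NLam M => (nd_size M).+1
  | NApp M N | NAdd M N => (nd_size M + nd_size N).+1
  end.

(** By classical logic a non-accessible term has a non-accessible reduct; choosing one repeatedly
    builds an infinite sequence. *)
Lemma strongly_normalizable_Acc M :
  strongly_normalizable M -> Acc (fun N' N => nd_step N N') M.
Proof.
move=> sn; apply: contrapT => nacc; apply: sn.
pose T := {N | ~ Acc (fun N' N => nd_step N N') N}.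
have next (x : T) : {y : T | nd_step (sval x) (sval y)}.
  apply: cid; case: x => N nN /=; apply: contrapT => nex.
  apply: nN; constructor=> N' r; apply: contrapT => nN'.
  by apply: nex; exists (exist _ N' nN').
exists (fun n => sval (iter n (fun x => sval (next x)) (exist _ M nacc))).
by split=> // n /=; case: (next _).
Qed.

(** Outer induction on the accessibility of [M], inner induction on the size of the terms embedded
    in [M]. A step of an embedded term is carried to [M] by [emb_step]. *)
Lemma strongly_normalizable_ind (P : ndterm -> Prop) :
  (forall M, (forall M' N, nd_step M M' -> emb M' N -> P N) ->
     (forall N, emb M N -> nd_size N < nd_size M -> P N) -> P M) ->
  forall M, strongly_normalizable M -> P M.
Proof.
move=> PH M /strongly_normalizable_Acc acc.
suff : forall N, emb M N -> P N by apply; apply: emb_refl.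
elim: acc => {}M _ IH N; move En : (nd_size N) => n.
elim/ltn_ind: n N En => n IHn N En eMN; apply: PH.
  move=> N' L r eL; have [M' rM eM'] := emb_step eMN r.
  by apply: IH rM _ _; apply: emb_trans eL.
move=> L eL lt_L; apply: IHn erefl _; first by rewrite -En.
exact: emb_trans eL.
Qed.

Definition summand N M := nd_eq M N \/ exists P, nd_eq M (NAdd N P).

Lemma summand_emb M N : summand N M -> emb M N.
Proof.
case=> [|[P]] e; first by apply: emb_eq e; apply: emb_refl.
by apply: (@emb_addl _ _ P); apply: emb_eq e; apply: emb_refl.
Qed.

Lemma summand_app N M P : summand N M -> summand (NApp N P) (NApp M P).
Proof.
case=> [e|[Q e]]; [left|right]; first by apply: nd_app => //; apply: nd_refl.
exists (NApp Q P); apply: nd_trans (nd_appD _ _ _).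
by apply: nd_app => //; apply: nd_refl.
Qed.

Lemma summand_addl N M P : summand N M -> summand N (NAdd M P).
Proof.
case=> [e|[Q e]]; right; first by exists P; apply: nd_add => //; apply: nd_refl.
exists (NAdd Q P); apply: nd_trans (nd_addA _ _ _).
by apply: nd_add => //; apply: nd_refl.
Qed.

Lemma summand_eq N M M' : nd_eq M M' -> summand N M' -> summand N M.
Proof.
move=> e [e'|[P e']]; [left|right]; first exact: nd_trans e e'.
by exists P; apply: nd_trans e e'.
Qed.

Lemma summand_addr N M P : summand N M -> summand N (NAdd P M).
Proof. by move/(summand_addl P); apply: summand_eq; apply: nd_addC. Qed.

Lemma summand_step N M N' : summand N M -> nd_step N N' ->
  exists2 M', nd_step M M' & summand N' M'.
Proof.
case=> [e|[P e]] r.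
  exists N'; last by left; apply: nd_refl.
  exact: nd_step_refine e r (nd_refl _).
exists (NAdd N' P); last by right; exists P; apply: nd_refl.
exact: nd_step_refine e (nd_step_addl P r) (nd_refl _).
Qed.

Lemma In_mapE (T U : Type) (f : T -> U) y l :
  List.In y (map f l) -> exists2 x, List.In x l & y = f x.
Proof. by case/List.in_map_iff => x [<- xl]; exists x. Qed.

Lemma lam_bodies_summand M P : List.In P (lam_bodies M) -> summand (NLam P) M.
Proof.
elim: M => //= [M _ [->|//]|M IHM N IHN].
  by left; apply: nd_refl.
move=> inP; case: (List.in_app_or _ _ _ inP) => [/IHM|/IHN].
  exact: summand_addl.
exact: summand_addr.
Qed.

(** The other summands survive in an actual beta-step, so a head reduct is obtained only as a
    summand of a reduct of [M]. *)
Lemma head_reducts_step M N : List.In N (head_reducts M) ->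
  exists2 M', nd_step M M' & summand N M'.
Proof.
elim: M N => //= [M IHM N _|M IHM N IHN] L.
  move=> inL; case: (List.in_app_or _ _ _ inL) => inL'; have [P inP ->] := In_mapE inL'.
    have [M' r s] := IHM _ inP; exists (NApp M' N); last exact: summand_app.
    exact: nd_step_appl.
  apply: (summand_step (summand_app N (lam_bodies_summand inP))).
  exact/nd_step_beta/nb_beta.
move=> inL; case: (List.in_app_or _ _ _ inL) => [/IHM|/IHN] [M' r s].
  by exists (NAdd M' N); [apply: nd_step_addl|apply: summand_addl].
by exists (NAdd M M'); [apply: nd_step_addr|apply: summand_addr].
Qed.

Lemma uniform_bound (T : Type) (P : T -> nat -> Prop) (l : seq T) :
  (forall x m n, m <= n -> P x m -> P x n) ->
  (forall x, List.In x l -> exists n, P x n) ->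
  exists n, forall x, List.In x l -> P x n.
Proof.
move=> mono; elim: l => [|x l IH] H; first by exists 0.
have [|n Hn] := IH; first by move=> y yl; apply: H; right.
have [|m Hm] := H x; first by left.
exists (maxn m n) => y [<-|/Hn]; first by apply: mono Hm; apply: leq_maxl.
exact/mono/leq_maxr.
Qed.

(** * Size bounds from strong normalization *)

Definition reaches (p : pred nat) (t : rtree) : Prop :=
  exists2 s, star (red true) t s & all_bag_sizes p s.

Lemma strongly_normalizable_bound M b : strongly_normalizable M ->
  exists K, forall t, taylor_tree M t -> reaches (leq^~ b) t -> tree_size t <= K.
Proof.
move: M; apply: strongly_normalizable_ind => -[i|M|M N|M N] IHstep IHsub.
- by exists 1; case.
- have [||K HK] := IHsub M => //; first exact/emb_lam/emb_refl.
  exists K.+1; case=> //= t Mt [_ /star_red_lam_inv[s -> r] bs].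
  by apply: HK => //; exists s.
- have [||K HK] := IHsub M; [exact/emb_appl/emb_refl|by rewrite /=; lia|].
  have [||L HL] := IHsub N; [exact/emb_appr/emb_refl|by rewrite /=; lia|].
  (* [H] bounds all the finitely many head reducts at once. *)
  have [||H HH] := @uniform_bound _ (fun M' K =>
      forall t, taylor_tree M' t -> reaches (leq^~ b) t -> tree_size t <= K)
      (head_reducts (NApp M N)).
  + by move=> x m n le_mn Hm t Mt rt; apply: leq_trans le_mn; apply: Hm.
  + by move=> M' /head_reducts_step[M1 r /summand_emb]; apply: IHstep.
  (* Without a head step, the function has size at most [K] and there are at most [b] arguments, of
     size at most [L]. Otherwise the head reduct has size at most [H], and [hred_tree_size]
     applies. *)
  exists (maxn (K + b * L).+1 (H.*2 + 2)); case=> // s l Mt [v r bv].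
  have [[s' [l' [ev rs el rl]]]|[u h ru]] := star_red_app_inv r; last first.
    have [M' inM' M'u] := taylor_tree_hred Mt h.
    have : tree_size u <= H by apply: HH inM' _ M'u _; exists v.
    by have := hred_tree_size h; lia.
  move: bv Mt; rewrite {}ev /= => /and3P[lel' bs' bl'] [Ms Nl].
  have : tree_size s <= K by apply: HK Ms _; exists s'.
  have : sumn (map tree_size l) <= size l * L.
    have {rl} : {in l, forall t, tree_size t <= L}.
      move=> t tl; apply: HL (Nl _ tl) _.
      by have [t' t'l' rt] := rl _ tl; exists t' => //; apply: (allP bl').
    elim: l {Nl el r} => //= t l IH /in_cons_forall[Ht /IH].
    by lia.
  have : size l * L <= b * L by rewrite leq_mul2r el lel' orbT.
  by lia.
- have [||K HK] := IHsub M; [exact/emb_addl/emb_refl|by rewrite /=; lia|].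
  have [||L HL] := IHsub N; [exact/emb_addr/emb_refl|by rewrite /=; lia|].
  exists (maxn K L) => t /= [Mt|Nt] rt; first by rewrite leq_max HK.
  by rewrite leq_max (HL t) ?orbT.
Qed.

(** * Weights from bounds on the terms that reach linear ones *)

Definition linearly_bounded (K : nat) (M : ndterm) : Prop :=
  forall t, taylor_tree M t -> reaches (pred1 1) t -> tree_size t < K.

(** The strict inequality turns a bound [K] for [N] into [K.-1] for [M], which drives the induction
    on bounds. *)
Definition dominated (M N : ndterm) : Prop :=
  forall t, taylor_tree M t -> reaches (pred1 1) t ->
    exists u, [/\ taylor_tree N u, reaches (pred1 1) u & tree_size t < tree_size u].

(** A linear element of the expansion reaches itself, which excludes 0 and makes [K.-1] strictly
    smaller than [K]. *)
Lemma linearly_bounded_gt0 K M : linearly_bounded K M -> 0 < K.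
Proof.
have [t Mt lt] := taylor_tree_linear M; case: K => // /(_ t Mt); apply.
by exists t => //; apply: star_refl.
Qed.

Lemma dominated_linearly_bounded K M N :
  dominated M N -> linearly_bounded K N -> linearly_bounded K.-1 M.
Proof.
move=> dMN bN t Mt rt; have [u [Nu ru]] := dMN _ Mt rt.
by have := bN _ Nu ru; lia.
Qed.

Lemma reaches_app s t : reaches (pred1 1) s -> reaches (pred1 1) t ->
  reaches (pred1 1) (RApp s [:: t]).
Proof.
move=> [s' rs ls] [t' rt lt]; exists (RApp s' [:: t']); last by rewrite /= ls lt.
by apply: star_red_app => //; do 2?constructor.
Qed.

Lemma reaches_linear t : all_bag_sizes (pred1 1) t -> reaches (pred1 1) t.
Proof. by exists t => //; apply: star_refl. Qed.

(** The added argument is a linear element of the expansion of [P], alone in its bag, so a linear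
    term is still reached. *)
Lemma dominated_app M N P : dominated M N -> dominated M (NApp N P).
Proof.
move=> dMN t Mt rt; have [u [Nu ru lt]] := dMN _ Mt rt.
have [p Pp lp] := taylor_tree_linear P; exists (RApp u [:: p]); split=> /=; last by lia.
  by split=> // q; rewrite inE => /eqP->.
by apply: reaches_app => //; apply: reaches_linear.
Qed.

Lemma dominated_arg M N : dominated N (NApp M N).
Proof.
move=> t Nt rt; have [s Ms ls] := taylor_tree_linear M; exists (RApp s [:: t]).
split=> /=; last by lia.
  by split=> // q; rewrite inE => /eqP->.
by apply: reaches_app => //; apply: reaches_linear.
Qed.

Lemma dominated_lam M : dominated M (NLam M).
Proof.
move=> t Mt [s r ls]; exists (RLam t); split=> //.
by exists (RLam s) => //; apply: star_map r => *; apply: red_lam.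
Qed.

Definition napps (M : ndterm) (Qs : seq ndterm) : ndterm := foldl NApp M Qs.

Lemma dominated_napps M N Qs : dominated M N -> dominated M (napps N Qs).
Proof. by elim: Qs N => //= Q Qs IH N d; apply/IH/dominated_app. Qed.

Lemma dominated_in M Q Qs : List.In Q Qs -> dominated Q (napps M Qs).
Proof.
elim: Qs M => //= P Qs IH M [->|/IH //].
exact/dominated_napps/dominated_arg.
Qed.

(** Every element of the expansion of the reduct arises by firing the redex in a strictly larger
    element of the expansion of the redex, which therefore reaches the same linear term. *)
Lemma dominated_beta P N Qs :
  dominated (napps (nsubst 0 N P) Qs) (napps (NApp (NLam P) N) Qs).
Proof.
suff H t : taylor_tree (napps (nsubst 0 N P) Qs) t ->
    exists u, [/\ taylor_tree (napps (NApp (NLam P) N) Qs) u, red true u t &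
      tree_size t < tree_size u].
  move=> t /H[u [Hu r lt]] [s rs ls]; exists u; split=> //.
  by exists s => //; apply: star_step r rs.
have : forall t, taylor_tree (nsubst 0 N P) t ->
    exists u, [/\ taylor_tree (NApp (NLam P) N) u, red true u t &
      tree_size t < tree_size u].
  move=> {}t /taylor_tree_osub_inv[p [l [Pp Nl H]]].
  exists (RApp (RLam p) l); split=> //; [exact: red_beta|exact: osub_tree_size_lt].
(* Reduct and redex become arbitrary terms [A] and [B] related by this property, which extends
   through each argument of the stack. *)
elim: Qs (nsubst 0 N P) (NApp _ _) t => [|Q Qs IH] A B t AB /=; first exact: AB.
apply: IH => {}t; case: t => // s l [/AB[u [Bu r lt]] Ql].
exists (RApp u l); split=> //=; [exact: red_appl|by lia].
Qed.

Lemma taylor_tree_napps M N Qs t : (forall t, taylor_tree M t -> taylor_tree N t) ->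
  taylor_tree (napps M Qs) t -> taylor_tree (napps N Qs) t.
Proof.
elim: Qs M N => [|Q Qs IH] M N MN /=; first exact: MN.
by apply: IH; case=> //= s l [/MN].
Qed.

(** Lexicographic induction on [K] and [M]. Stack elements, bodies and reducts have the bound
    [K.-1]; applications and sums keep [K] and pass to a subterm of [M]. *)
Lemma linearly_bounded_weight K M Qs :
  linearly_bounded K (napps M Qs) -> exists n, weight M Qs n.
Proof.
elim/ltn_ind: K M Qs => K IH; elim=> [i|P _|M IHM N _|M IHM N IHN] Qs bM.
- have gt0 := linearly_bounded_gt0 bM.
  have : forall Q, List.In Q Qs -> exists n, weight Q [::] n.
    move=> Q /(@dominated_in (NVar i))/dominated_linearly_bounded/(_ bM).
    by move=> bQ; apply: (IH K.-1 _ Q [::] bQ); rewrite prednK.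
  elim: Qs {bM} => [|Q Qs IHQs] H; first by exists 1; constructor.
  have [|m wm] := H Q; first by left.
  have [|n wn] := IHQs; first by move=> R RQs; apply: H; right.
  by exists (m + n); constructor.
- have gt0 := linearly_bounded_gt0 bM.
  case: Qs bM => [|N Qs] bM.
    have [||n w] := IH K.-1 _ P [::]; first by rewrite prednK.
      exact: dominated_linearly_bounded (@dominated_lam P) bM.
    by exists n; constructor.
  have [||a wa] := IH K.-1 _ (nsubst 0 N P) Qs; first by rewrite prednK.
    exact: dominated_linearly_bounded (@dominated_beta P N Qs) bM.
  have [||b wb] := IH K.-1 _ N [::]; first by rewrite prednK.
    apply: dominated_linearly_bounded bM.
    by apply: dominated_in; left.
  by exists (a * b.+1); constructor.
- by have [n w] := IHM (N :: Qs) bM; exists n; constructor.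
- have [|a wa] := IHM Qs.
    by move=> t Mt; apply: bM; apply: taylor_tree_napps Mt => u; left.
  have [|b wb] := IHN Qs.
    by move=> t Mt; apply: bM; apply: taylor_tree_napps Mt => u; right.
  by exists (a + b); constructor.
Qed.

(** * From ordered terms to resource terms *)

Lemma perm_bag_list b l :
  perm_eq (enum_mset b) l -> perm_eq (bag_list b) (map rtval l).
Proof. by move=> e; rewrite /bag_list perm_sort perm_map. Qed.

Lemma perm_bag_list_seq l : perm_eq (bag_list (seq_mset l)) (map rtval l).
Proof. exact/perm_bag_list/perm_eq_seq_mset. Qed.

Lemma mem_bag_list (b : {mset rterm}) t :
  t \in bag_list b -> exists2 u, t = rtval u & u \in b.
Proof.
rewrite mem_sort => /mapP[u ub ->]; by exists u.
Qed.

Lemma mem_seq_mset (T : choiceType) (x : T) (l : seq T) :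
  (x \in seq_mset l) = (x \in l).
Proof. exact: perm_mem (perm_eq_seq_mset l) x. Qed.

Lemma mem_lin_ext f (a : {mset rterm}) t :
  t \in lin_ext f a <-> exists2 u, u \in a & t = f u.
Proof.
rewrite /lin_ext mem_seq_mset; split=> [/mapP[u ua ->]|[u ua ->]].
  by exists u.
exact: map_f.
Qed.

Lemma mem_sum_scale n (a : {mset rterm}) t :
  t \in sum_scale n a = (0 < n) && (t \in a).
Proof.
elim: n => [|n IH] /=; rewrite ?in_mset0 // in_msetD IH.
by case: (t \in a); rewrite ?andbF.
Qed.

Lemma mem_big_msetD (I : finType) (F : I -> {mset rterm}) t :
  t \in \big[msetD/mset0]_i F i <-> exists i, t \in F i.
Proof.
have H r : (t \in \big[msetD/mset0]_(i <- r) F i) = has (fun i => t \in F i) r.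
  by elim: r => [|i r IH]; rewrite ?big_nil ?in_mset0 // big_cons in_msetD IH.
rewrite H; split=> [/hasP[i _ ti]|[i ti]]; first by exists i.
by apply/hasP; exists i => //; apply: mem_index_enum.
Qed.

(** Canonical forms only reorder bags, so both directions hold even when [b] is false. *)
Lemma star_red_rnorm b u :
  star (red b) u (rtval (rnorm u)) /\ star (red b) (rtval (rnorm u)) u.
Proof.
elim/rtree_nested_ind: u => [i|t [IH1 IH2]|s ts [IH1 IH2] IHts] /=.
- by split; apply: star_refl.
- by split; apply: (star_map (@red_lam b)).
have e : perm_eq (map (fun t => rtval (rnorm t)) ts)
                 (bag_list (seq_mset (map rnorm ts))).
  by rewrite perm_sym (map_comp rtval rnorm) perm_bag_list_seq.
have [H1 H2] : reds_bag b ts (map (fun t => rtval (rnorm t)) ts) /\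
    reds_bag b (map (fun t => rtval (rnorm t)) ts) ts.
  elim: ts IHts {e} => [|t ts IH] /=; first by split; constructor.
  by case/in_cons_forall=> -[? ?] /IH[? ?]; split; constructor.
split.
  apply: star_trans (star_red_app IH1 H1) _.
  exact/star1/red_perm.
apply: star_trans (star_red_app IH2 H2).
by apply/star1/red_perm; rewrite perm_sym.
Qed.

Lemma star_red_invariant b T (f : rtree -> T) :
  (forall t t', red b t t' -> f t = f t') ->
  forall t t', star (red b) t t' -> f t = f t'.
Proof. by move=> H t t'; elim=> {t t'} // t t1 t2 /H -> _. Qed.

Lemma red_false_rnorm t t' : red false t t' -> rnorm t = rnorm t'.
Proof.
elim=> {t t'} //=.
- move=> s l l' e; congr rapp; apply/eq_seq_msetP; exact: perm_map.
- by move=> t t' _ ->.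
- by move=> s s' l _ ->.
- by move=> s l1 t t' l2 _ IH; rewrite !map_cat /= IH.
Qed.

Lemma red_false_tree_size t t' : red false t t' -> tree_size t = tree_size t'.
Proof.
elim=> {t t'} //=.
- by move=> s l l' e; rewrite (perm_tree_size e).
- by move=> t t' _ ->.
- by move=> s s' l _ ->.
- by move=> s l1 t t' l2 _ IH; rewrite !map_cat /= IH.
Qed.

Lemma red_false_all_bag_sizes p t t' :
  red false t t' -> all_bag_sizes p t = all_bag_sizes p t'.
Proof.
elim=> {t t'} //=.
- by move=> s l l' e; rewrite (perm_size e) (perm_all _ e).
- by move=> s s' l _ ->.
- by move=> s l1 t t' l2 _ IH; rewrite !size_cat !all_cat /= IH.
Qed.

Lemma tree_size_rnorm t : tree_size (rtval (rnorm t)) = tree_size t.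
Proof.
exact: (star_red_invariant red_false_tree_size (proj2 (star_red_rnorm false t))).
Qed.

Lemma taylor_taylor_tree M T : taylor M T -> taylor_tree M (rtval T).
Proof.
elim: M T => [i|M IH|M IHM N IHN|M IHM N IHN] T /=.
- by move=> ->.
- by case=> t Mt <- /=; apply: IH.
- case=> s Ms [b Nb <-]; split; first exact: IHM.
  by move=> _ /mem_bag_list[t -> tb]; apply: IHN; apply: Nb.
- by case=> [/IHM|/IHN]; [left|right].
Qed.

Lemma taylor_tree_taylor M t : taylor_tree M t -> taylor M (rnorm t).
Proof.
elim: M t => [i|M IH|M IHM N IHN|M IHM N IHN] t /=.
- by case: t => //= j ->.
- by case: t => //= t Mt; exists (rnorm t) => //; apply: IH.
- case: t => //= s l [Ms Nl]; exists (rnorm s); first exact: IHM.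
  exists (seq_mset (map rnorm l)) => // t.
  by rewrite mem_seq_mset => /mapP[u ul ->]; apply: IHN; apply: Nl.
- by case=> [/IHM|/IHN]; [left|right].
Qed.

(** * Simulation between resource reduction and ordered reduction *)

Lemma rred1_star_red t a u :
  rred1 t a -> u \in a -> star (red true) (rtval t) (rtval u).
Proof.
move=> r; elim: r u => {t a} [t b|t a _ IH|t a b _ IH|u t a b _ IH] v.
- rewrite /diff_subst; case: eqP => [e|_]; last by rewrite in_mset0.
  case/mem_big_msetD => f; rewrite in_mset1 => /eqP-> /=.
  set l := (X in occ_subst _ X _).
  (* The permutation [f] becomes a reordering of the bag, performed before the redex is fired. *)
  have pl : perm_eq (bag_list b) l.
    rewrite /l /image_mem (map_comp rtval (tnth (in_tuple (enum_mset b)) \o f)).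
    apply: perm_bag_list; rewrite perm_sym.
    by apply/(@tuple_permP _ _ _ (in_tuple (enum_mset b))); exists f.
  apply: star_trans (proj1 (star_red_rnorm true _)).
  apply: star_step (red_perm _ _ pl) _.
  apply/star1/red_beta => //; apply: occ_subst_osub.
  by rewrite e -(perm_size pl) size_sort size_map.
- case/mem_lin_ext => u ua -> /=; apply: (star_map (@red_lam true)).
  exact: IH.
- case/mem_lin_ext => u ua -> /=.
  apply: (star_map (f := RApp^~ (bag_list b))) (IH _ ua) => *; exact: red_appl.
- case/mem_lin_ext => t' ta -> /=.
  (* The enumeration of the enlarged bag is sorted afresh, so [x] has to be moved to the front. *)
  have p x : perm_eq (bag_list (x +` b)) (rtval x :: bag_list b).
    rewrite -[b]seq_mset_id -mset_cons (permPl (perm_bag_list_seq _)) /=.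
    by rewrite perm_cons perm_sym perm_bag_list_seq.
  apply: star_step (red_perm _ _ (p t)) _.
  apply: star_trans (_ : star _ (RApp (rtval u) (rtval t' :: bag_list b)) _).
    apply: (star_map (f := fun t => RApp (rtval u) (t :: bag_list b))) (IH _ ta).
    by move=> x y; apply: (@red_appr true _ [::]).
  by apply/star1/red_perm; rewrite perm_sym.
Qed.

(** Read backwards, each element of a reduced sum descends from an element of the initial sum. *)
Lemma rge_star_red t s : rge t s -> star (red true) (rtval t) (rtval s).
Proof.
case=> a r sa; suff H : forall a b, rreds a b -> forall s, s \in b ->
    exists2 t, t \in a & star (red true) (rtval t) (rtval s).
  by have [u + ru] := H _ _ r _ sa; rewrite in_mset1 => /eqP <-.
move=> {r sa s t}a b; elim=> {a b}.
- move=> _ _ [n t a b n0 r] s; rewrite in_msetD mem_sum_scale.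
  case/orP=> [/andP[_ sa]|sb].
    exists t; last exact: rred1_star_red sa.
    by rewrite in_msetD msetn1 lt0n n0.
  by exists s; [rewrite in_msetD sb orbT|apply: star_refl].
- by move=> a s sa; exists s => //; apply: star_refl.
- move=> a b c _ IH1 _ IH2 s /IH2[u /IH1[t ta r1] r2].
  by exists t => //; apply: star_trans r1 r2.
Qed.

(** A reordering leaves the canonical form unchanged; firing a redex picks out the summand of one
    permutation. *)
Lemma red_rred1 t t' : red true t t' ->
  rnorm t = rnorm t' \/ exists2 a, rred1 (rnorm t) a & rnorm t' \in a.
Proof.
elim=> {t t'} /=.
- move=> t l u _ H; right; exists (diff_subst (rnorm t) (seq_mset (map rnorm l))).
    exact: rr_beta.
  (* The body [rnorm t] may list its occurrences in another order: [l2] is [l] reordered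
     accordingly, and its elements are then put in canonical form. *)
  have [l2 [u2 [e H2 r2]]] := star_red_osub (proj2 (star_red_rnorm false t)) H.
  have [|u3 H3 r3] := @osub_reds_bag false 0 _
      (map rtval (map rnorm l2)) _ _ _ H2.
    elim: (l2) => [|x l3 IH] /=; constructor => //.
    exact: (proj2 (star_red_rnorm _ _)).
  have -> : rnorm u = rnorm u3.
    rewrite (star_red_invariant red_false_rnorm r3).
    by rewrite (star_red_invariant red_false_rnorm r2).
  set B := seq_mset _.
  have p : perm_eq (map rnorm l2) (in_tuple (enum_mset B)).
    rewrite perm_sym /= (permPl (perm_eq_seq_mset _)); exact: perm_map.
  have sB : size l2 = size B by rewrite -(perm_size p) size_map.
  have := osub_size H3; rewrite !size_map sB => e3.
  rewrite /diff_subst -e3 eqxx; apply/mem_big_msetD.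
  have [f ef] := tuple_permP p; exists f; rewrite in_mset1; apply/eqP; congr rnorm.
  rewrite /image_mem (map_comp rtval (tnth (in_tuple (enum_mset B)) \o f)).
  rewrite ef in H3; apply: osub_inj H3 _; apply: occ_subst_osub.
  by rewrite size_map size_tuple.
- by move=> s l l' e; left; congr rapp; apply/eq_seq_msetP; exact: perm_map.
- move=> t t' _ [->|[a r ta]]; [by left|right].
  by exists (lin_ext rlam a); [apply: rr_lam|apply/mem_lin_ext; exists (rnorm t')].
- move=> s s' l _ [->|[a r sa]]; [by left|right].
  exists (lin_ext (rapp^~ (seq_mset (map rnorm l))) a); first exact: rr_appl.
  by apply/mem_lin_ext; exists (rnorm s').
- move=> s l1 t t' l2 _ IH.
  have e x : seq_mset (map rnorm (l1 ++ x :: l2)) =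
      rnorm x +` seq_mset (map rnorm (l1 ++ l2)).
    rewrite -mset_cons; apply/eq_seq_msetP; rewrite !map_cat /=.
    by rewrite perm_catC /= perm_cons perm_catC.
  rewrite !e; case: IH => [->|[a r ta]]; [by left|right].
  eexists; first exact: rr_appr r.
  by apply/mem_lin_ext; exists (rnorm t').
Qed.

(** All the copies of [u] in the sum are isolated and reduced at once; as coefficients are natural
    numbers, [v] cannot cancel. *)
Lemma rge_rred1 t u a v : rge t u -> rred1 u a -> v \in a -> rge t v.
Proof.
case=> c rc uc r va.
have eu : c = (msetn (c u) u `+` (c `\` msetn (c u) u))%mset.
  apply/msetP => w; rewrite !msetE2 msetnE; case: eqP => [->|_]; lia.
exists (sum_scale (c u) a `+` (c `\` msetn (c u) u))%mset.
  apply: Relation_Operators.rt_trans rc _; apply: Relation_Operators.rt_step.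
  rewrite {1}eu; apply: rr_sum r; by rewrite -lt0n -in_mset.
by rewrite in_msetD mem_sum_scale va -in_mset uc.
Qed.

Lemma star_red_rge t s : star (red true) t s -> rge (rnorm t) (rnorm s).
Proof.
move=> r; suff H u : rge u (rnorm t) -> rge u (rnorm s).
  apply: H; exists [mset rnorm t]; last by rewrite in_mset1.
  exact: Relation_Operators.rt_refl.
elim: r => {t s} // t t1 s r _ IH H; apply: IH.
by have [<-|[a ra ta]] := red_rred1 r => //; apply: rge_rred1 ra ta.
Qed.

(** * Finiteness of the elements of bounded size *)

Lemma finite_seq_bounded (T : eqType) (A : set T) n :
  finite_set A ->
  finite_set [set l : seq T | size l <= n /\ {in l, forall x, A x}].
Proof.
move=> fA; elim: n => [|n IH].
  apply: sub_finite_set (finite_set1 [::]) => l [].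
  by rewrite leqn0 size_eq0 => /eqP.
apply: (@sub_finite_set _ _ ([set [::]] `|` [set x :: l | x in A & l in
    [set l : seq T | size l <= n /\ {in l, forall x, A x}]])).
  case=> [|x l] [le_n Al]; first by left.
  have [Ax Al'] := proj1 (in_cons_forall A x l) Al.
  by right; exists x => //; exists l.
rewrite finite_setU; split; first exact: finite_set1.
exact: finite_image2.
Qed.

(** Arguments have size at least 1, so [K] bounds the lengths of the bags as well as the sizes of
    their elements. *)
Lemma finite_taylor_tree M K : finite_set [set t | taylor_tree M t /\ tree_size t <= K].
Proof.
elim: M => [i|M IH|M IHM N IHN|M IHM N IHN].
- by apply: sub_finite_set (finite_set1 (RVar i)) => -[j|t|s l] [] //= ->.
- apply: sub_finite_set (finite_image RLam IH).
  by case=> [i|t|s l] [] //= Mt le_t; exists t => //; split=> //; apply: ltnW.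
- apply: sub_finite_set (finite_image2 RApp IHM (finite_seq_bounded K IHN)).
  case=> [i|t|s l] [] //= [Ms Nl] le_K; have le_l := size_le_tree_size l.
  exists s; first by split=> //; lia.
  exists l => //; split; first by lia.
  move=> t tl; split; first exact: Nl.
  by have /= := perm_tree_size (perm_to_rem tl); lia.
- apply: (@sub_finite_set _ _ ([set t | taylor_tree M t /\ tree_size t <= K] `|`
                               [set t | taylor_tree N t /\ tree_size t <= K])).
    by move=> t /= [[Mt|Nt] le]; [left|right].
  by rewrite finite_setU.
Qed.

Lemma finite_taylor M K : finite_set [set t | taylor M t /\ tree_size (rtval t) <= K].
Proof.
apply: (@sub_finite_set _ _
  (rtval @^-1` [set t | taylor_tree M t /\ tree_size t <= K])).
  by move=> t /= [/taylor_taylor_tree].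
apply: finite_preimage (finite_taylor_tree M K) => s t _ _; exact: val_inj.
Qed.

Lemma finite_set_bounded (T : eqType) (A : set T) (f : T -> nat) :
  finite_set A -> exists n, forall x, A x -> f x < n.
Proof.
case/finite_seqP => s ->; exists (\max_(x <- s) f x).+1 => x /= xs.
by rewrite ltnS; apply: leq_bigmax_seq.
Qed.

Theorem theorem2 (M : ndterm) :
  (strongly_normalizable M ->
   forall T : structure, T `<=` bounded_structure -> orth (cones T) (taylor M))
  /\
  (forall T : structure, linear_structure `<=` T ->
   orth (cones T) (taylor M) -> strongly_normalizable M).
Proof.
split=> [sn T TB _ [a Ta <-]|T LT oM].
  have [n Hn] := TB _ Ta; have [K HK] := strongly_normalizable_bound n sn.
  (* An element [t] of the cone reduces to some [s] in [a], whose bags have at most [n] elements;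
     hence [K] bounds the size of [t]. *)
  apply: sub_finite_set (finite_taylor M K) => t [Mt [s sa /rge_star_red r]].
  split=> //; apply: HK; first exact: taylor_taylor_tree.
  by exists (rtval s) => //; apply: Hn.
(* [L] is the largest set of linear terms; its cone meets the expansion in a finite set, whose sizes
   lie below some [K]. *)
pose L : set rterm := [set t | linear_rterm t].
have TL : T L by apply: LT.
have [K HK] := finite_set_bounded (fun t => tree_size (rtval t))
  (oM _ (ex_intro2 _ _ L TL erefl)).
have [|n w] := @linearly_bounded_weight K M [::]; last first.
  exact: weight_strongly_normalizable w.
(* The bound concerns resource terms, so [t] is replaced by [rnorm t], which has the same size and
   reaches the linear [rnorm s]. *)
move=> t Mt [s r ls]; rewrite -tree_size_rnorm; apply: HK; split.
  exact: taylor_tree_taylor.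
exists (rnorm s); last exact: star_red_rge.
have e := star_red_invariant (@red_false_all_bag_sizes (pred1 1))
  (proj2 (star_red_rnorm false s)).
by rewrite /L /= /linear_rterm e.
Qed.
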